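(* Let $n\ge 1$ be an integer such that $n+1$ is a perfect square. Then the remainder polynomial $R_{(n,n)}(x)$ is irreducible in $\mathbb{Z}[x]$.
   Context: $\mathrm{He}_k(x)$ denotes the monic probabilists' Hermite polynomial of degree $k$ (the polynomial solution of $y''-xy'+ky=0$; e.g. $\mathrm{He}_0=1$, $\mathrm{He}_1=x$, $\mathrm{He}_2=x^2-1$). A partition $\lambda=(\lambda_1\ge\lambda_2\ge\dots\ge\lambda_r\ge 0)$ may have zero parts; $|\lambda|=\sum_i\lambda_i$. Its degree sequence is $n_\lambda=(\lambda_r,\lambda_{r-1}+1,\dots,\lambda_1+r-1)$. Let $\Delta(x_1,\dots,x_r)=\prod_{1\le i<j\le r}(x_j-x_i)$. The Wronskian Hermite polynomial is $\mathrm{He}_\lambda(x)=\mathrm{Wr}[\mathrm{He}_{n_1},\dots,\mathrm{He}_{n_r}]/\Delta(n_\lambda)$ where $n_\lambda=(n_1,\dots,n_r)$; it is monic of degree $|\lambda|$ with integer coefficients. Removing a $2$-hook from $\lambda$ means replacing some entry $a$ of $n_\lambda$ by $a-2$, where $a-2\ge 0$ and $a-2\notin n_\lambda$, and taking the partition of the same length with the new set as degree sequence. Removing $2$-hooks until none remain gives the $2$-core $\bar\lambda$ (independent of choices), which is a staircase $(m,m-1,\dots,1)$ padded with zeros, so $|\bar\lambda|=\binom{m+1}{2}$. One has $\mathrm{He}_\lambda(x)=x^{|\bar\lambda|}R_\lambda(x)$ with $R_\lambda\in\mathbb{Z}[x]$, $R_\lambda(0)\ne 0$; $R_\lambda$ is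 called the remainder polynomial. *)

(* Defs.v *)
From mathcomp Require Import all_boot all_order all_algebra.
Set Implicit Arguments. Unset Strict Implicit. Unset Printing Implicit Defensive.
Import GRing.Theory Num.Theory.
Local Open Scope ring_scope.

Fixpoint He (k : nat) : {poly int} :=
  match k with
  | 0 => 1
  | k'.+1 =>
      match k' with
      | 0 => 'X
      | k''.+1 => 'X * He k' - (k'%:R) *: He k''
      end
  end.

Definition is_partition (la : seq nat) : Prop := sorted geq la.

Definition degseq (la : seq nat) : seq nat :=
  [seq (nth 0%N la (size la - 1 - i) + i)%N | i <- iota 0 (size la)].

Definition wronskianHe (s : seq nat) : {poly int} :=
  \det (\matrix_(i < size s, j < size s) (He (nth 0%N s j))^`(i)).

Definition vdm (s : seq nat) : int :=
  \prod_(i < size s) \prod_(j < size s | (i < j)%N)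
     ((nth 0%N s j)%:Z - (nth 0%N s i)%:Z).

(* Wronskian Hermite polynomial He_lambda = Wr / Delta (exact division
   of the integer coefficients). *)
Definition HeW (la : seq nat) : {poly int} :=
  let s := degseq la in
  map_poly (fun c : int => (c %/ vdm s)%Z) (wronskianHe s).

(* Removing a 2-hook: replace an entry a of the degree sequence by a-2,
   where a-2 >= 0 and a-2 is not in the degree sequence. *)
Definition removable2 (s : seq nat) (a : nat) : bool :=
  (2 <= a)%N && ((a - 2)%N \notin s).

Definition remove2hook (s : seq nat) : seq nat :=
  let i := find (removable2 s) s in
  if (i < size s)%N then set_nth 0%N s i (nth 0%N s i - 2)%N else s.

(* Removing 2-hooks until none remain (each removal lowers the sum by 2,
   so sumn s iterations suffice). *)
Definition core2_degs (s : seq nat) : seq nat := iter (sumn s) remove2hook s.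

(* |mu| for a partition mu of length r with degree set d equals
   sum(d) - binom(r,2).  This is the size of the 2-core. *)
Definition core2_size (la : seq nat) : nat :=
  (sumn (core2_degs (degseq la)) - 'C(size la, 2))%N.

(* Remainder polynomial: He_lambda = x^{|core|} R_lambda. *)
Definition remainderPoly (la : seq nat) : {poly int} :=
  drop_poly (core2_size la) (HeW la).

Definition irreducible_Zx (p : {poly int}) : Prop :=
  p != 0 /\ ~~ (p \is a GRing.unit) /\
  forall q r : {poly int}, p = q * r -> q \is a GRing.unit \/ r \is a GRing.unit.

(* Main.v *)
From Stdlib Require Import BinNat Nnat.
Require Import Defs.
From mathcomp Require Import all_boot all_order all_algebra.
From mathcomp Require Import finfield zify ring.
Set Implicit Arguments. Unset Strict Implicit. Unset Printing Implicit Defensive.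
Import Order.TTheory GRing.Theory Num.Theory.

(** With f = He_n and g = He_(n+1), the Wronskian is
    W = (n+1) f^2 + g^2 - x f g = P(x^2), and the 2-core is empty.  The
    valuations of the coefficients of He_k give enough of the p-adic Newton
    polygon of P, for p odd not dividing n + 1, to show that a factor of P of
    degree d satisfies d <= n mod p when p > 2d, and d mod p <= n mod p when
    p^2 > n + 1.  For n + 1 = k^2 and 1 <= d <= n/2 it follows that every prime
    factor of 'C(n, d) is at most min(2d, k); since each prime power dividing
    'C(n, d) is at most n, a size estimate excludes d >= 5, the primes dividing
    k^2 - 2 and k^2 - 3 exclude 2 <= d <= 4, and d = 1 leaves only n = 8, which
    is excluded modulo 13.  So P is irreducible.
    If W = A B, then A(x) A(-x) B(x) B(-x) = P(x^2)^2, so A(x) A(-x) = P(x^2) up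
    to sign for a nontrivial factor A.  If n is odd the sign at 0 is wrong.  If
    n is even then 8 divides n; write A(x) A(-x) = E(y)^2 - y O(y)^2 with
    y = x^2, and take a prime p = 3 mod 4 dividing n - 1.  There
    P = y^(n-1) (y + 1) mod p, and at y = -1 a sum of two squares vanishes, so
    E and O vanish too, although -1 is a simple root of P. *)

(** * Prime factors of binomial coefficients *)

(** The terms with [p ^ t > n] vanish, so Legendre's sum may run up to any [m >= n]; a common range
    allows termwise subtraction in [logn_bin]. *)
Lemma logn_fact_sum p n m : prime p -> n <= m ->
  logn p n`! = \sum_(1 <= t < m.+1) n %/ p ^ t.
Proof.
move=> pp le_nm; rewrite logn_fact // [RHS](big_cat_nat _ (n := n.+1)) //=.
rewrite [X in _ = _ + X]big_nat_cond [X in _ = _ + X]big1 ?addn0 // => t.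
rewrite andbT => /andP[lt_nt _]; apply: divn_small.
exact: leq_trans lt_nt (ltnW (ltn_expl _ (prime_gt1 pp))).
Qed.

(** Kummer's theorem: the summand at [t] is the carry out of the lowest [t] digits in the base [p]
    addition of [d] and [n - d]. *)
Lemma logn_bin p n d : prime p -> d <= n ->
  logn p 'C(n, d) =
    \sum_(1 <= t < n.+1) (p ^ t <= d %% p ^ t + (n - d) %% p ^ t).
Proof.
move=> pp le_dn.
have /(congr1 (logn p)) := bin_fact le_dn.
rewrite lognM ?bin_gt0 // ?muln_gt0 ?fact_gt0 // lognM ?fact_gt0 //.
rewrite !(@logn_fact_sum p _ n) // ?leq_subr //.
have -> : \sum_(1 <= t < n.+1) n %/ p ^ t = \sum_(1 <= t < n.+1)
   (p ^ t <= d %% p ^ t + (n - d) %% p ^ t) +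
   (\sum_(1 <= t < n.+1) d %/ p ^ t + \sum_(1 <= t < n.+1) (n - d) %/ p ^ t).
  rewrite -!big_split /=; apply: eq_bigr => t _.
  rewrite -{1}(subnKC le_dn) divnD ?expn_gt0 ?prime_gt0 //; lia.
by move/addIn.
Qed.

(** Kummer's sum has at most one carry for each [t >= 1] with [p ^ t <= n], and none beyond. *)
Lemma prime_power_bin_le p n d : prime p -> 0 < n -> d <= n ->
  p ^ logn p 'C(n, d) <= n.
Proof.
move=> pp n0 le_dn; set k := trunc_log p n.
have p1 := prime_gt1 pp.
apply: leq_trans (trunc_logP p1 n0); rewrite leq_exp2l // logn_bin //.
have le_kn : k <= n.
  by apply: leq_trans (trunc_logP p1 n0); apply/ltnW/ltn_expl.
rewrite (big_cat_nat _ (n := k.+1)) //= [X in _ + X]big_nat_cond [X in _ + X]big1.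
  rewrite addn0; apply: (@leq_trans (\sum_(1 <= t < k.+1) 1)).
    by apply: leq_sum => t _; apply: leq_b1.
  by rewrite sum_nat_const_nat; lia.
move=> t; rewrite andbT => /andP[lt_kt _].
have lt_nt : n < p ^ t.
  by apply: leq_trans (trunc_log_ltn n p1) _; rewrite leq_exp2l.
rewrite [d %% _]modn_small ?[(n - d) %% _]modn_small; lia.
Qed.

Lemma leq_prod_primes (B : nat -> nat) m y : 0 < m ->
  (forall p, prime p -> p %| m -> p <= y /\ p ^ logn p m <= B p) ->
  (forall p, prime p -> 0 < B p) ->
  m <= \prod_(p <- iota 0 y.+1 | prime p) B p.
Proof.
move=> m0 hm B0.
rewrite {1}(prod_prime_decomp m0) prime_decompE big_map /=.
have -> : \prod_(j <- primes m) j ^ logn j m =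
          \prod_(j <- iota 0 y.+1 | j \in primes m) j ^ logn j m.
  rewrite -[in RHS]big_filter; apply: perm_big; apply: uniq_perm.
  - exact: primes_uniq.
  - exact/filter_uniq/iota_uniq.
  move=> p; rewrite mem_filter mem_iota /= add0n ltnS.
  case: (boolP (p \in primes m)) => //=; rewrite mem_primes => /and3P[pp _ pm].
  by case: (hm _ pp pm).
rewrite big_mkcond [X in _ <= X]big_mkcond /=.
apply: leq_prod => p _; case: ifP => [|_].
  by rewrite mem_primes => /and3P[pp _ pm]; rewrite pp; case: (hm _ pp pm).
by case: ifP => // pp; apply: B0.
Qed.

Definition primepi y := count prime (iota 0 y.+1).

Lemma bin_le_expn_primepi n d y : 0 < n -> d <= n ->
  (forall p, prime p -> p %| 'C(n, d) -> p <= y) -> 'C(n, d) <= n ^ primepi y.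
Proof.
move=> n0 le_dn hy.
have := @leq_prod_primes (fun=> n) 'C(n, d) y.
rewrite bin_gt0 big_const_seq iter_muln_1; apply=> // p pp hp.
by split; [apply: hy | apply: prime_power_bin_le].
Qed.

(** Each factor [(n - i) / (d - i)] of the binomial coefficient is at least [n / d]. *)
Lemma expn_le_bin n d : d <= n -> n ^ d <= 'C(n, d) * d ^ d.
Proof.
move=> le_dn; suff: forall i, i <= d -> n ^ i * d ^_ i <= n ^_ i * d ^ i.
  move/(_ d (leqnn d)); rewrite ffactnn -bin_ffact -mulnA [d`! * _]mulnC mulnA.
  by rewrite leq_pmul2r ?fact_gt0.
elim=> [|i IH] lt_id; first by rewrite !expn0 !ffactn0.
rewrite !expnSr !ffactnSr mulnACA [X in _ <= X]mulnACA.
by apply: leq_mul; [apply/IH/ltnW | nia].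
Qed.

Lemma leq_bin_half n d e : d <= e -> e.*2 <= n -> 'C(n, d) <= 'C(n, e).
Proof.
elim: e => [|e IH]; first by rewrite leqn0 => /eqP->.
rewrite leq_eqVlt => /predU1P[-> //|lt_de] le_en.
apply: leq_trans (IH lt_de _) _; first lia.
have := mul_bin_left n e; nia.
Qed.

(** * Upper bounds for the number of primes *)

Lemma count_iota_periodic (a : pred nat) q m : (forall i, a (i + q) = a i) ->
  count a (iota m q) = count a (iota 0 q).
Proof.
move=> aq; elim: m => [|m <-] //; have := iotaD m 1 q; have := iotaD m q 1.
rewrite addn1 => -> /(congr1 (count a)); rewrite !count_cat /= !addn0 aq addn1; lia.
Qed.

Lemma count_coprime210 m : count (coprime 210) (iota m 210) = 48.
Proof.
have Nmod i : coprime 210 (i + 210) = coprime 210 i by rewrite /coprime gcdnDr.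
by rewrite (count_iota_periodic _ Nmod); vm_compute.
Qed.

Lemma prime_coprime210 p : prime p -> 7 < p -> coprime 210 p.
Proof.
move=> pp p7; rewrite -[210]/(2 * (3 * (5 * 7))) !coprimeMl !prime_coprime //.
by rewrite !dvdn_prime2 //; apply/and4P; split; lia.
Qed.

Lemma sub_in_count (T : eqType) (a b : pred T) (s : seq T) :
  {in s, forall x, a x -> b x} -> count a s <= count b s.
Proof.
elim: s => //= x s IH ab; apply: leq_add.
  by have := ab x (mem_head _ _); case: (a x) => // ->.
by apply: IH => y ys; apply: ab; rewrite inE ys orbT.
Qed.

Lemma count_prime_iota210 m : 7 < m -> count prime (iota m 210) <= 48.
Proof.
move=> m7; apply: leq_trans (eq_leq (count_coprime210 m)).
apply: sub_in_count => p; rewrite mem_iota => /andP[le_mp _] pp.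
by rewrite prime_coprime210 //; apply: leq_trans m7 _.
Qed.

(** A window of 210 integers above 7 holds at most 48 primes, and [4 * 48 <= 210], so the bound
    propagates from the values 120 to 329, which are computed. *)
Lemma primepi_le_quarter y : 120 <= y -> 4 * primepi y <= y.
Proof.
elim/ltn_ind: y => y IH y120; have [y330|y330] := ltnP y 330.
  have /allP : all (fun y => 4 * primepi y <= y) (iota 120 210) by vm_compute.
  by apply; rewrite mem_iota; lia.
have /IH : y - 210 < y by lia.
have := @count_prime_iota210 (y - 210).+1.
have -> : primepi y = primepi (y - 210) + count prime (iota (y - 210).+1 210).
  rewrite /primepi -count_cat -{2}[(y - 210).+1]add0n -iotaD.
  by congr (count _ (iota _ _)); lia.
lia.
Qed.

Lemma primepi_le_half y : 9 <= y -> (primepi y).*2 < y.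
Proof.
elim/ltn_ind: y => y IH y9; have [y11|y11] := ltnP y 11.
  by have [->|->] : y = 9 \/ y = 10 by lia.
have /IH : y - 2 < y by lia.
have -> : primepi y = primepi (y - 2) + count prime (iota (y - 2).+1 2).
  rewrite /primepi -count_cat -{2}[(y - 2).+1]add0n -iotaD.
  by congr (count _ (iota _ _)); lia.
suff: count prime (iota (y - 2).+1 2) <= 1 by lia.
have Podd p : prime p -> odd p || (p == 2) by move/even_prime => [->|->].
rewrite /= addn0; move: (Podd (y - 2).+1) (Podd (y - 2).+2).
case: (prime (y - 2).+1) => [/(_ isT) h1|_]; last by case: (prime _).
by case: (prime (y - 2).+2) => [/(_ isT) h2|_] //; lia.
Qed.

(** * Binomial coefficients against smooth numbers, computed in binary *)

Fixpoint ffactN (n : N) d := if d is d'.+1 then N.mul n (ffactN (N.pred n) d') else 1%num.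

Lemma ffactNE n d : N.to_nat (ffactN n d) = (N.to_nat n) ^_ d.
Proof.
by elim: d n => [|d IH] n //=; rewrite N2Nat.inj_mul IH N2Nat.inj_pred ffactnS.
Qed.

(** For [p > 1], starting from [acc = 1], the fuel [f] suffices to reach the largest power of [p]
    not exceeding [n] as soon as [n < 2 ^ f]. *)
Fixpoint max_powN f (p n acc : N) :=
  if f is f'.+1 then
    if N.leb (N.mul acc p) n then max_powN f' p n (N.mul acc p) else acc
  else acc.

Lemma max_powN_ge f p n acc a v : (1 < N.to_nat p) ->
  N.to_nat acc = (N.to_nat p) ^ a -> v <= a + f ->
  (N.to_nat p) ^ v <= N.to_nat n ->
  (N.to_nat p) ^ v <= N.to_nat (max_powN f p n acc).
Proof.
move=> p1; elim: f acc a => [|f IH] acc a accE le_v le_pn /=.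
  by rewrite accE leq_exp2l // -[a]addn0.
case: N.leb_spec => [_|lt_n].
  by apply: (IH _ a.+1); rewrite ?N2Nat.inj_mul ?accE ?expnSr //; lia.
rewrite accE leq_exp2l // -ltnS -(ltn_exp2l _ _ p1) expnSr -accE.
by apply: leq_ltn_trans le_pn _; lia.
Qed.

Definition smooth_boundN f n y :=
  foldr (fun p => N.mul (max_powN f (N.of_nat p) n 1)) 1%num
    [seq p <- iota 0 y.+1 | prime p].

Lemma smooth_boundNE f n y : N.to_nat (smooth_boundN f n y) =
  \prod_(p <- iota 0 y.+1 | prime p) N.to_nat (max_powN f (N.of_nat p) n 1).
Proof.
rewrite /smooth_boundN -big_filter; elim: filter => [|p s IH] /=.
  by rewrite big_nil.
by rewrite big_cons N2Nat.inj_mul IH.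
Qed.

(** With [n = k^2 - 1], the second test says that ['C(n, d)] is larger than the product, over the
    primes [p <= y], of the largest power of [p] up to [n]; the first test makes the fuel
    sufficient. *)
Definition bin_exceeds f y d k :=
  let n := N.pred (N.mul (N.of_nat k) (N.of_nat k)) in
  N.ltb n (N.pow 2 (N.of_nat f)) &&
  N.ltb (N.mul (smooth_boundN f n y) (ffactN (N.of_nat d) d)) (ffactN n d).

Lemma to_nat_exp2 f : N.to_nat (N.pow 2 (N.of_nat f)) = 2 ^ f.
Proof.
elim: f => [|f IH] //; rewrite Nat2N.inj_succ N.pow_succ_r ?N2Nat.inj_mul ?IH ?expnS //.
exact: N.le_0_l.
Qed.

(** The index [e] may differ from [d], so that a computation for ['C(n, k)] also serves for the
    larger coefficients ['C(n, d)]. *)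
Lemma bin_exceedsP f y d k n e : bin_exceeds f y d k -> n.+1 = k ^ 2 ->
  0 < n -> e <= n -> 'C(n, d) <= 'C(n, e) ->
  exists p, [/\ prime p, p %| 'C(n, e) & y < p].
Proof.
case/andP => /N.ltb_spec0 lt_nf /N.ltb_spec0 lt_bin nk n0 le_en le_bin_de.
set nN := N.pred _ in lt_nf lt_bin.
have nNE : N.to_nat nN = n by rewrite /nN; lia.
have nf : n < 2 ^ f by rewrite -nNE -to_nat_exp2; lia.
case: (boolP (has (fun p => y < p) (primes 'C(n, e)))) => [/hasP[p]|/hasPn hy].
  by rewrite mem_primes => /and3P[? _ ?] ?; exists p.
suff le_bin : 'C(n, e) <= N.to_nat (smooth_boundN f nN y).
  have: ('C(n, d) * d`! <= N.to_nat (smooth_boundN f nN y) * d`!).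
    by rewrite leq_mul2r (leq_trans le_bin_de le_bin) orbT.
  have : N.to_nat (N.mul (smooth_boundN f nN y) (ffactN (N.of_nat d) d)) <
         N.to_nat (ffactN nN d) by lia.
  by rewrite N2Nat.inj_mul !ffactNE Nat2N.id nNE ffactnn bin_ffact -multE; lia.
rewrite smooth_boundNE; apply: leq_prod_primes; rewrite ?bin_gt0 // => p pp.
  move=> p_bin; split.
    by rewrite leqNgt; apply: hy; rewrite mem_primes pp bin_gt0 le_en.
  rewrite -{1}(Nat2N.id p); apply: (@max_powN_ge _ _ _ _ 0).
  - by rewrite Nat2N.id prime_gt1.
  - by [].
  - rewrite -(leq_exp2l _ _ (isT : 1 < 2)); apply: leq_trans (ltnW nf).
    apply: leq_trans (prime_power_bin_le pp n0 le_en).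
    by case: (logn p _) => // v; rewrite leq_exp2r ?prime_gt1.
  by rewrite Nat2N.id nNE prime_power_bin_le.
apply: leq_trans (_ : p ^ 0 <= _) => //.
rewrite -{1}(Nat2N.id p); apply: (@max_powN_ge _ _ _ _ 0) => //.
  by rewrite Nat2N.id prime_gt1.
by rewrite nNE.
Qed.

(* For 5 <= d < 60, the entry of index d - 5 bounds the k to be checked by
   computation: from there on n^(d - primepi (2d)) exceeds d^d. *)
Definition thresholds : seq nat := [::
  58; 219; 910; 67; 143; 319; 84; 146; 67; 43; 61; 87; 58; 44; 57; 45; 57;
  73; 57; 72; 58; 50; 60; 51; 45; 53; 63; 55; 49; 57; 51; 59; 68; 61; 55;
  63; 57; 65; 60; 55; 62; 57; 54; 51; 56; 53; 58; 63; 60; 65; 72; 68; 74;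
  70; 66].

(** Fuel 20 is enough because the largest threshold is 910 and [910 ^ 2 < 2 ^ 20]. *)
Lemma bin_exceeds_small d k : 5 <= d < 60 -> d < k < nth 0 thresholds (d - 5) ->
  bin_exceeds 20 (minn d.*2 k) d k.
Proof.
move=> d5 dk; have /allP : all (fun d => all (fun k => bin_exceeds 20 (minn d.*2 k) d k)
   (iota d.+1 (nth 0 thresholds (d - 5) - d.+1))) (iota 5 55) by vm_compute.
move/(_ d); rewrite mem_iota => /(_ d5)/allP/(_ k); apply.
by rewrite mem_iota; lia.
Qed.

Lemma leq_expr m n e : m <= n -> m ^ e <= n ^ e.
Proof. by case: e => // e; rewrite leq_exp2r. Qed.

(** The doubled exponent comes from [n = k^2 - 1 >= (k - 1)^2]. Only the threshold itself is
    computed; larger [k] follow by monotonicity. *)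
Lemma threshold_exceeds d k : 5 <= d < 60 -> nth 0 thresholds (d - 5) <= k ->
  d ^ d < k.-1 ^ (d - primepi d.*2).*2.
Proof.
pose K d := nth 0 thresholds (d - 5); move=> d60 le_Kk.
have /allP/(_ d) : all (fun d => N.ltb (N.pow (N.of_nat d) (N.of_nat d))
   (N.pow (N.of_nat (K d).-1) (N.of_nat (d - primepi d.*2).*2))) (iota 5 55).
  by vm_compute.
rewrite mem_iota => /(_ d60)/N.ltb_spec0; move: (_ - _).*2 => e lt_N.
have powE m i : N.to_nat (N.pow (N.of_nat m) (N.of_nat i)) = m ^ i.
  elim: i => [|i IH] //; rewrite Nat2N.inj_succ N.pow_succ_r ?N2Nat.inj_mul.
    by rewrite IH Nat2N.id expnS.
  exact: N.le_0_l.
have lt_nat : d ^ d < (K d).-1 ^ e by rewrite -!powE; lia.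
by apply: leq_trans lt_nat (leq_expr _ _); rewrite -subn1 -[k.-1]subn1 leq_sub2r.
Qed.

Lemma square_not_mod q c k t : all (fun r => r ^ 2 %% q != c %% q) (iota 0 q) ->
  0 < q -> k ^ 2 <> t * q + c.
Proof.
move=> /allP qr q0 /(congr1 (modn^~ q)) /eqP; apply/negP.
rewrite modnMDl -modnXm; apply: qr.
by rewrite mem_iota ltn_mod.
Qed.

Lemma prime_dvd_fact p d : prime p -> p %| d`! -> p <= d.
Proof.
move=> pp; elim: d => [|d IH]; first by rewrite dvdn1 => /eqP p1; rewrite p1 in pp.
by rewrite factS Euclid_dvdM // => /orP[/dvdn_leq->|/IH/leqW].
Qed.

Lemma prime_dvd_bin_sub p n d j : prime p -> d < p -> j < d -> d <= n ->
  p %| n - j -> p %| 'C(n, d).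
Proof.
move=> pp lt_dp lt_jd le_dn pj.
have : p %| 'C(n, d) * d`!.
  rewrite bin_ffact; elim: d lt_jd {lt_dp le_dn} => // d IH.
  rewrite ltnS leq_eqVlt ffactnSr => /predU1P[<-|/IH]; first exact: dvdn_mull.
  exact: dvdn_mulr.
rewrite Euclid_dvdM // => /orP[] // /(prime_dvd_fact pp); lia.
Qed.

(** Squaring produces [d ^ 2], which can be compared with [n.+1 = k ^ 2]. *)
Lemma leq_expn_double n C d s : n ^ d <= C * d ^ d -> C <= n ^ s ->
  n ^ d.*2 <= n ^ s.*2 * (d ^ 2) ^ d.
Proof.
move=> le_nC le_Cn; rewrite -!muln2 -[(d ^ 2) ^ d]expnM [2 * d]mulnC !expnM -expnMn.
rewrite leq_exp2r //; apply: leq_trans le_nC _.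
by rewrite leq_mul2r le_Cn orbT.
Qed.

(** The quotient of [m] by [gcdn m b] exceeds 1, and any prime factor of it will do. It is prime to
    [b] when no prime factor of [b] has its square dividing [m]. *)
Lemma prime_mul_gcd_dvd m b : 0 < b < m -> exists2 p, prime p & p * gcdn m b %| m.
Proof.
case/andP=> b0 lt_bm; exists (pdiv (m %/ gcdn m b)).
  apply: pdiv_prime; rewrite -(ltn_pmul2r (_ : 0 < gcdn m b)) ?gcdn_gt0 ?b0 ?orbT //.
  rewrite mul1n divnK ?dvdn_gcdl //; apply: leq_ltn_trans lt_bm.
  by rewrite dvdn_leq ?dvdn_gcdr.
by rewrite -dvdn_divRL ?dvdn_gcdl // pdiv_dvd.
Qed.

(** * Binomial coefficients of [k^2 - 1] without large prime factors *)

Section SquareCase.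
Variables (n k d : nat).
Hypotheses (nk : n.+1 = k ^ 2) (d0 : 0 < d) (dn : d.*2 <= n).
Hypothesis bin_smooth :
  forall p, prime p -> p %| 'C(n, d) -> p <= d.*2 /\ p <= k.

Let n0 : 0 < n. Proof. lia. Qed.
Let le_dn : d <= n. Proof. lia. Qed.
Let bin2d := fun p (pp : prime p) (pC : p %| 'C(n, d)) => (bin_smooth pp pC).1.
Let bink := fun p (pp : prime p) (pC : p %| 'C(n, d)) => (bin_smooth pp pC).2.

(** This is [(1 + 1/n)^i (1 - i/n) <= 1] cleared of denominators. *)
Lemma expn_mul_succ_sub i : i <= n -> n.+1 ^ i * (n - i) <= n ^ i.+1.
Proof.
elim: i => [|i IH] le_in; first by rewrite mul1n subn0.
rewrite expnSr -mulnA; apply: (@leq_trans (n.+1 ^ i * ((n - i) * n))).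
  by rewrite leq_mul2l; apply/orP; right; nia.
by rewrite mulnA [n ^ i.+2]expnSr leq_mul2r IH ?orbT // ltnW.
Qed.

(** If [k <= d], then ['C(n, k)] is at most ['C(n, d)], all of whose primes are at most [k]. For
    [k >= 9] these number fewer than [k / 2], which forces [n ^ k.+1 <= n.+1 ^ k], against
    [expn_mul_succ_sub]; smaller [k] are computed. *)
Lemma smooth_bin_lt_root : d < k.
Proof.
have k1 : 1 < k by nia.
rewrite ltnNge; apply/negP => le_kd.
have le_bin : 'C(n, k) <= 'C(n, d) by apply: leq_bin_half.
have [k9|k9] := ltnP k 9.
  have k3 : 3 <= k by nia.
  have /allP/(_ k) : all (fun k => bin_exceeds 20 k k k) (iota 3 6) by vm_compute.
  rewrite mem_iota k3 k9 => /(_ isT) exc.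
  have [p [pp pC]] := bin_exceedsP exc nk n0 le_dn le_bin.
  by rewrite ltnNge bink.
have le_kn : k <= n by nia.
have lo := expn_le_bin le_kn.
have hi := leq_trans le_bin (bin_le_expn_primepi n0 le_dn bink).
have pik := primepi_le_half k9.
have sq : n ^ k.*2 <= n ^ k.-1 * n.+1 ^ k.
  rewrite nk; apply: leq_trans (leq_expn_double lo hi) _.
  by rewrite leq_mul2r leq_pexp2l ?n0 ?orbT //; lia.
have : n ^ k.+1 <= n.+1 ^ k.
  rewrite -(@leq_pmul2l (n ^ k.-1)) ?expn_gt0 ?n0 // -expnD.
  by have -> : k.-1 + k.+1 = k.*2 by lia.
have := expn_mul_succ_sub le_kn.
have : 0 < n.+1 ^ k by rewrite expn_gt0.
nia.
Qed.

(** The size estimate would give [n <= d ^ 2], whereas [d < k] makes [d ^ 2] smaller than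
    [k ^ 2 - 1]. *)
Lemma smooth_bin_primepi : (primepi d.*2).*2 <= d -> False.
Proof.
move=> pid; have dk := smooth_bin_lt_root.
have lo := expn_le_bin le_dn.
have hi := bin_le_expn_primepi n0 le_dn bin2d.
have sq : n ^ d.*2 <= n ^ d * (d ^ 2) ^ d.
  apply: leq_trans (leq_expn_double lo hi) _.
  by rewrite leq_mul2r leq_pexp2l ?n0 ?orbT.
have : n ^ d <= (d ^ 2) ^ d.
  by rewrite -(@leq_pmul2l (n ^ d)) ?expn_gt0 ?n0 // -expnD addnn.
by rewrite leq_exp2r //; nia.
Qed.

Lemma smooth_bin_lt60 : d < 60.
Proof.
rewrite ltnNge; apply/negP => d60; apply: smooth_bin_primepi.
have := @primepi_le_quarter d.*2; lia.
Qed.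

Lemma smooth_bin_lt5 : d < 5.
Proof.
rewrite ltnNge; apply/negP => d5; have d60 := smooth_bin_lt60; have dk := smooth_bin_lt_root.
(* Below the threshold a computation exhibits a prime factor above [2d] or [k]; from the threshold
   on, [n ^ (d - primepi d.*2) <= d ^ d] is contradicted. *)
have [kt|kt] := ltnP k (nth 0 thresholds (d - 5)).
  have exc : bin_exceeds 20 (minn d.*2 k) d k by apply: bin_exceeds_small; lia.
  have [p [pp pC]] := bin_exceedsP exc nk n0 le_dn (leqnn _).
  by have := bin_smooth pp pC; lia.
have le_pi : primepi d.*2 <= d by have := @primepi_le_half d.*2; lia.
have lo := expn_le_bin le_dn.
have hi := bin_le_expn_primepi n0 le_dn bin2d.
have /threshold_exceeds/(_ kt) : 5 <= d < 60 by lia.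
apply/negP; rewrite -leqNgt -mul2n expnM.
apply: (@leq_trans (n ^ (d - primepi d.*2))); first by apply: leq_expr; nia.
rewrite -(@leq_pmul2l (n ^ primepi d.*2)) ?expn_gt0 ?n0 // -expnD subnKC //.
by apply: leq_trans lo _; rewrite leq_mul2r hi orbT.
Qed.

Lemma pred_square_factor (p j c : nat) : j < d -> d < p -> prime p ->
  n - j = k ^ 2 - c -> p %| k ^ 2 - c -> p <= d.*2.
Proof.
by move=> lt_jd lt_dp pp <- pj; apply: bin2d (prime_dvd_bin_sub pp lt_dp lt_jd le_dn pj).
Qed.

Lemma dvd_square_sub q c : c <= k ^ 2 -> q %| k ^ 2 - c -> exists t, k ^ 2 = t * q + c.
Proof. by move=> le_ck /dvdnP[t E]; exists t; rewrite -E subnK. Qed.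

Lemma smooth_bin_eq1 : d = 1.
Proof.
have dk := smooth_bin_lt_root; have d5 := smooth_bin_lt5.
suff : ~ (1 < d) by lia.
move=> d1; have k2 : 8 <= k ^ 2 by nia.
have nsq q c : q %| k ^ 2 - c -> c <= 3 -> 0 < q ->
    all (fun r => r ^ 2 %% q != c %% q) (iota 0 q) -> False.
  move=> qk c3 q0 nres; have [|t] := @dvd_square_sub q c _ qk; first lia.
  exact: square_not_mod.
have step c b : 0 < c <= 3 -> 0 < b < k ^ 2 - c -> c.-1 < d ->
    (forall q, prime q -> q %| b -> ~ (q * q %| k ^ 2 - c)) ->
    exists p, [/\ prime p, p %| k ^ 2 - c, ~~ (p %| b) & p <= d.*2].
  move=> c3 b0 lt_cd nb; have [p pp pm] := prime_mul_gcd_dvd b0.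
  have pb : ~~ (p %| b).
    apply/negP => pb; apply: (nb p pp pb); apply: dvdn_trans (pm).
    by rewrite dvdn_mul // dvdn_gcd pb (dvdn_trans (dvdn_mulr _ _) pm).
  exists p; split=> //; first exact: dvdn_trans (dvdn_mulr _ _) pm.
  have [|lt_dp] := leqP p d; first lia.
  apply: (@pred_square_factor p c.-1 c) => //; first lia.
  exact: dvdn_trans (dvdn_mulr _ _) pm.
have odd_range p : prime p -> p <= 8 -> p \in [:: 2; 3; 5; 7].
  by move=> pp p8; have : p \in [seq p <- iota 0 9 | prime p];
     [rewrite mem_filter pp mem_iota | vm_compute].
have [d4|d3] : d = 4 \/ d < 4 by lia.
  (* As 3 is not a square modulo 4 or 9, some prime other than 2 and 3 divides [n - 2 = k^2 - 3]. It
     is at most 8, but 3 is not a square modulo 5 or 7. *)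
  have [||||p [pp pm p6 p8]] := step 3 6 => //.
  - nia.
  - by rewrite d4.
  - move=> q qp; rewrite -[6]/(2 * 3) Euclid_dvdM // (@dvdn_prime2 q 2) // (@dvdn_prime2 q 3) //.
    by case/orP=> /eqP-> /nsq; apply.
  have {}p8 : p \in [:: 2; 3; 5; 7] by apply: odd_range => //; lia.
  by move: p8 pm p6; rewrite !inE => /or4P[] /eqP-> // /nsq; apply.
(* As 2 is not a square modulo 4, some odd prime divides [n - 1 = k^2 - 2]. It is at most 6, but 2
   is not a square modulo 3 or 5. *)
have [||||p [pp pm p2 p6]] := step 2 2 => //.
- nia.
- by move=> q qp; rewrite (@dvdn_prime2 q 2) // => /eqP-> /nsq; apply.
have p8 : p \in [:: 2; 3; 5; 7] by apply: odd_range => //; lia.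
move: p8 p6 pm p2; rewrite !inE => /or4P[] /eqP->; last lia.
- by [].
- by move=> _ /nsq h _; apply: h.
by move=> _ /nsq h _; apply: h.
Qed.

(** For [d = 1] the only prime factor of [n = (k - 1)(k + 1)] is 2, so two powers of 2 differ by
    2. *)
Lemma smooth_bin_root_eq3 : k = 3.
Proof.
have dk := smooth_bin_lt_root; have d1 := smooth_bin_eq1.
have pown : 2.-nat n.
  apply/pnatP => // p pp pn; rewrite inE /=.
  have [] := bin_smooth pp; first by rewrite d1 bin1.
  by have := prime_gt1 pp; rewrite d1; lia.
have nE : n = k.-1 * k.+1 by nia.
have : 2.-nat k.-1 && 2.-nat k.+1 by rewrite -pnatM -nE.
case/andP => /p_natP[a ka] /p_natP[b kb].
have dvd : 2 ^ a %| 2 ^ b by apply: dvdn_exp2l; rewrite -(leq_exp2l _ _ (isT : 1 < 2)); lia.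
have /dvdn_leq : k.-1 %| 2.
  have <- : k.+1 - k.-1 = 2 by lia.
  by apply: dvdn_sub (dvdnn _); rewrite ka kb.
have : k <> 2 by move=> k2; move: pown; have -> : n = 3 by lia.
lia.
Qed.
End SquareCase.

Lemma bin_square_pred_smooth n k d : n.+1 = k ^ 2 -> 0 < d -> d.*2 <= n ->
  (forall p, prime p -> p %| 'C(n, d) -> p <= d.*2 /\ p <= k) -> n = 8 /\ d = 1.
Proof.
move=> nk d0 dn sm; split; last exact: smooth_bin_eq1 nk d0 dn sm.
by have := nk; rewrite (smooth_bin_root_eq3 nk d0 dn sm) => -[].
Qed.

(** * Newton polygons *)

Local Open Scope ring_scope.
Local Arguments He : simpl never.

Definition vp (p : nat) (c : int) := logn p `|c|%N.

Lemma vpM p c d : c != 0 -> d != 0 -> vp p (c * d) = (vp p c + vp p d)%N.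
Proof. by move=> c0 d0; rewrite /vp abszM lognM // absz_gt0. Qed.

Lemma vpD p c d : prime p -> c + d != 0 -> c != 0 -> d != 0 ->
  (minn (vp p c) (vp p d) <= vp p (c + d)%R)%N.
Proof.
move=> pp cd0 c0 d0; set m := minn _ _.
rewrite /vp -(pfactor_dvdn _ pp) ?absz_gt0 //.
have dvdP (x : int) : x != 0 -> (m <= vp p x)%N -> ((p ^ m)%N %| x)%Z.
  by move=> x0; rewrite /vp -(pfactor_dvdn _ pp) ?absz_gt0.
have : ((p ^ m)%N %| c + d)%Z by rewrite rpredD ?dvdP // /m ?geq_minl ?geq_minr.
by rewrite dvdzE.
Qed.

Section Newton.
Variables (p A B : nat).
Hypothesis pp : prime p.

(** For [A > 0] this is the linear form on the points (index, valuation) whose level lines have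
    slope [- B / A]. *)
Definition weight (c : int) (t : nat) := (A * vp p c + B * t)%N.

(* (w, i) is lexicographically at most (weight c t, t), or c = 0. *)
Definition above w i t (c : int) :=
  (c == 0) || (w < weight c t)%N || ((w == weight c t) && (i <= t)%N).

Definition poly_above w i (f : {poly int}) := forall t, above w i t f`_t.

(* The minimum w of [weight f`_t t] is attained, for the first time at t = i. *)
Definition initial w i (f : {poly int}) :=
  poly_above w i f /\ ~~ above w i.+1 i f`_i.

Lemma above0 w i t : above w i t 0. Proof. by rewrite /above eqxx. Qed.

Lemma aboveN w i t c : above w i t (- c) = above w i t c.
Proof. by rewrite /above /weight /vp abszN oppr_eq0. Qed.

Lemma aboveD w i t c d : above w i t c -> above w i t d -> above w i t (c + d).
Proof.
have [->|c0] := eqVneq c 0; first by rewrite add0r.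
have [->|d0] := eqVneq d 0; first by rewrite addr0.
have [->|cd0] := eqVneq (c + d) 0; first by rewrite above0.
have := vpD pp cd0 c0 d0.
rewrite /above (negPf c0) (negPf d0) (negPf cd0) /= /weight.
move: (vp p c) (vp p d) (vp p (c + d)) => x y z le_z.
have [le|le] : (x <= z)%N \/ (y <= z)%N by lia.
  by have := leq_mul (leqnn A) le; lia.
by have := leq_mul (leqnn A) le; lia.
Qed.

Lemma above_sum w i t (I : Type) (r : seq I) (P : pred I) (F : I -> int) :
  (forall j, P j -> above w i t (F j)) -> above w i t (\sum_(j <- r | P j) F j).
Proof.
by move=> h; apply: (big_ind (above w i t)) => //; apply: aboveD.
Qed.

Lemma aboveM w i t c w' i' t' d : above w i t c -> above w' i' t' d ->
  above (w + w') (i + i') (t + t') (c * d).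
Proof.
have [->|c0] := eqVneq c 0; first by rewrite mul0r above0.
have [->|d0] := eqVneq d 0; first by rewrite mulr0 above0.
rewrite /above mulf_eq0 (negPf c0) (negPf d0) /= /weight vpM //; lia.
Qed.

Lemma above_le w i t c w' i' : above w i t c ->
  (w' < w)%N || (w' == w) && (i' <= i)%N -> above w' i' t c.
Proof. rewrite /above; case: (c == 0) => //=; lia. Qed.

Lemma poly_aboveD w i f g : poly_above w i f -> poly_above w i g ->
  poly_above w i (f + g).
Proof. by move=> hf hg t; rewrite coefD aboveD. Qed.

Lemma poly_aboveN w i f : poly_above w i f -> poly_above w i (- f).
Proof. by move=> hf t; rewrite coefN aboveN. Qed.

Lemma poly_aboveM w i f w' i' g : poly_above w i f -> poly_above w' i' g ->
  poly_above (w + w') (i + i') (f * g).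
Proof.
move=> hf hg t; rewrite coefM; apply: above_sum => -[j /= lt_jt] _.
by have := aboveM (hf j) (hg (t - j)%N); rewrite subnKC.
Qed.

Lemma poly_above_le w i f w' i' : poly_above w i f ->
  (w' < w)%N || (w' == w) && (i' <= i)%N -> poly_above w' i' f.
Proof. by move=> hf le t; apply: above_le (hf t) le. Qed.

Lemma initial_neq0 w i f : initial w i f -> f`_i != 0 /\ weight f`_i i = w.
Proof.
case=> /(_ i); rewrite /above; case: eqP => //= _; split=> //; lia.
Qed.

(* Dumas' theorem on the Newton polygon of a product *)
Lemma initialM w i f w' i' g : initial w i f -> initial w' i' g ->
  initial (w + w') (i + i') (f * g).
Proof.
move=> hf hg; have [fi0 fiE] := initial_neq0 hf; have [gi0 giE] := initial_neq0 hg.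
split; first by apply: poly_aboveM; [case: hf | case: hg].
have lt_i : (i < (i + i').+1)%N by lia.
rewrite coefM (bigD1 (Ordinal lt_i)) //= addKn; apply/negP => habs.
(* Every other product contributing to the coefficient of index [i + i'] is lexicographically
   higher; if the coefficient were too, so would be the product of the two initial terms. *)
have : above (w + w') (i + i').+1 (i + i') (f`_i * g`_i').
  rewrite -[f`_i * _](addrK (\sum_(j < (i + i').+1 | j != Ordinal lt_i) f`_j * g`_(i + i' - j))).
  apply: aboveD => //; rewrite aboveN; apply: above_sum => -[j /= lt_j].
  rewrite -val_eqE /= => ne_ji; case: hf => hf _; case: hg => hg _.
  have [lt_ji|le_ij] := ltnP j i.
    have : above w i.+1 j f`_j.
      by move: (hf j); rewrite /above; case: eqP => //= _; case: ltnP => //= _; lia.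
    by move/aboveM => /(_ _ _ _ _ (hg (i + i' - j)%N)); rewrite addSn subnKC.
  have lt_ij : (i < j)%N by rewrite ltn_neqAle eq_sym ne_ji.
  have : above w' i'.+1 (i + i' - j) g`_(i + i' - j).
    move: (hg (i + i' - j)%N); rewrite /above; case: eqP => //= _.
    by case: ltnP => //= _; lia.
  by move/(aboveM (hf j)); rewrite addnS subnKC.
rewrite /above mulf_eq0 (negPf fi0) (negPf gi0) /= /weight vpM //.
by move: fiE giE; rewrite /weight => <- <-; rewrite !mulnDr addnACA !ltnn andbF.
Qed.

Lemma initialD w i f g : initial w i f -> poly_above w i.+1 g -> initial w i (f + g).
Proof.
case=> hf nf hg; split.
  by apply: poly_aboveD => //; apply: poly_above_le hg _; rewrite eqxx leqnSn orbT.
rewrite coefD; apply: contra nf => h.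
by rewrite -[f`_i](addrK g`_i) aboveD // aboveN.
Qed.

Lemma initial_uniq w i w' i' f : initial w i f -> initial w' i' f ->
  w = w' /\ i = i'.
Proof.
move=> h h'; have [fi fiE] := initial_neq0 h; have [fi' fiE'] := initial_neq0 h'.
case: h h' => [h _] [h' _]; move: (h i') (h' i).
by rewrite /above (negPf fi) (negPf fi') fiE fiE' /=; clear; lia.
Qed.

Lemma initial_exists f : f != 0 -> exists w i, initial w i f.
Proof.
move=> f0; pose P w := has (fun t => (f`_t != 0) && (weight f`_t t == w)) (iota 0 (size f)).
have exw : exists w, P w.
  exists (weight (lead_coef f) (size f).-1); apply/hasP; exists (size f).-1.
    by rewrite mem_iota /= prednK ?size_poly_gt0.
  by rewrite -lead_coefE lead_coef_eq0 f0 eqxx.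
have [w Pw minw] := ex_minnP exw.
have exi : exists i, (f`_i != 0) && (weight f`_i i == w).
  by case/hasP: Pw => i _ ?; exists i.
have [i /andP[fi /eqP fiE] mini] := ex_minnP exi.
exists w, i; split=> [t|]; last by rewrite /above (negPf fi) fiE eqxx !ltnn.
rewrite /above; case: eqP => //= /eqP ft.
have le_w : (w <= weight f`_t t)%N.
  apply: minw; apply/hasP; exists t; last by rewrite ft eqxx.
  by rewrite mem_iota /=; rewrite ltnNge; apply: contra ft => /(nth_default 0) ->.
move: le_w (mini t); rewrite ft eq_sym leq_eqVlt /=.
by case: (w == _) => /= [_ /(_ isT)->|-> _]; rewrite ?orbT.
Qed.

(** Both factors have initial terms, and uniqueness for the product identifies their sums. *)
Lemma initial_factor w i f g : initial w i (f * g) ->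
  exists w1 i1 w2 i2, [/\ initial w1 i1 f, initial w2 i2 g,
     w = (w1 + w2)%N & i = (i1 + i2)%N].
Proof.
move=> h; have [fg0 _] := initial_neq0 h.
have : f * g != 0 by apply: contraNneq fg0 => ->; rewrite coef0.
rewrite mulf_eq0 => /norP[/initial_exists[w1 [i1 h1]] /initial_exists[w2 [i2 h2]]].
by exists w1, i1, w2, i2; split=> //; case: (initial_uniq h (initialM h1 h2)).
Qed.

Lemma initial_le w i f t : initial w i f -> f`_t != 0 -> (w <= weight f`_t t)%N.
Proof. by case=> /(_ t); rewrite /above => + _ => /orP[/orP[->|/ltnW]|/andP[/eqP->]] //. Qed.

End Newton.

(** * Hermite polynomials *)

Lemma HeS k : He k.+2 = 'X * He k.+1 - k.+1%:R *: He k.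
Proof. by []. Qed.

Lemma deriv_HeS k : (He k.+1)^`() = k.+1%:R *: He k.
Proof.
elim/ltn_ind: k => -[_|[_|k IH]]; first by rewrite derivX scale1r.
  rewrite HeS !derivE /= /He; apply/polyP => i; rewrite !coefE; case: i => [|i]//=; ring.
rewrite HeS derivB derivM derivX derivZ !IH // HeS -!mul_polyC !polyC_natr; ring.
Qed.

Lemma deriv_He k : (He k)^`() = 'X * He k - He k.+1.
Proof.
case: k => [|k]; first by rewrite mulr1 subrr derivE.
by rewrite deriv_HeS HeS opprB addrC subrK.
Qed.

Lemma He_monic_size k : (He k \is monic) * (size (He k) = k.+1).
Proof.
suff H : (size (He k) = k.+1) /\ lead_coef (He k) = 1.
  by case: H => s l; rewrite monicE l eqxx.
elim/ltn_ind: k => -[_|[_|k IH]]; first by rewrite size_poly1 lead_coef1.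
  by rewrite size_polyX lead_coefX.
have [s1 l1] := IH k.+1 (ltnSn _); have [s0 _] := IH k (ltnW (ltnSn _)).
have sX : size ('X * He k.+1) = k.+3.
  by rewrite mulrC size_mulX ?s1 // -size_poly_gt0 s1.
have sZ : (size (- (k.+1%:R *: He k)) < size ('X * He k.+1)%R)%N.
  by rewrite size_polyN sX (leq_ltn_trans (size_scale_leq _ _)) // s0.
by rewrite HeS size_polyDl // lead_coefDl // sX lead_coefM lead_coefX mul1r l1.
Qed.

Lemma He_monic k : He k \is monic. Proof. by rewrite He_monic_size. Qed.
Lemma size_He k : size (He k) = k.+1. Proof. by rewrite He_monic_size. Qed.

Lemma He_coef_parity k i : odd (k + i) -> (He k)`_i = 0.
Proof.
elim/ltn_ind: k i => -[_|[_|k IH]] i.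
- by rewrite coef1; case: i.
- by rewrite coefX; case: i => [|[|i]].
move=> oki; rewrite HeS coefB coefZ coefXM.
have -> : (He k)`_i = 0 by apply: IH; lia.
case: i oki => [|i] oki /=; first by rewrite mulr0 subr0.
by rewrite IH ?mulr0 ?subr0 //; lia.
Qed.

(** The closed form [(-1)^l k! / (i! l! 2^l)], multiplied out so as to stay in the integers. *)
Lemma He_coef k i l : (i + l.*2 = k)%N ->
  (He k)`_i * (i`! * l`! * 2 ^ l)%N%:R = (-1) ^+ l * k`!%:R.
Proof.
elim/ltn_ind: k i l => -[_|[_|k IH]] i l.
- by case: i l => [|i] [|l] //= _; rewrite coef1.
- by case: i l => [|[|i]] [|l] //= _; rewrite coefX.
rewrite HeS coefB coefZ coefXM => E.
case: l i E => [|l] [|i] E /=; first by move: E; lia.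
- have := IH k.+1 (ltnSn _) i 0%N; rewrite !fact0 !muln1 mul1r addn0 => H.
  rewrite [(He k)`_i.+1]nth_default ?size_He; last by lia.
  have -> : k.+2 = i.+1 by lia.
  have ik : i = k.+1 by lia.
  by rewrite mulr0 subr0 mul1r [in LHS]factS natrM mulrCA H // -ik -natrM -factS.
- have H := IH k (ltnW (ltnSn _)) 0%N l ltac:(lia).
  have kE : k.+2%:R = 2 * l.+1%:R :> int by rewrite -natrM; congr _%:R; lia.
  transitivity (- k.+1%:R * (2 * l.+1%:R) * ((He k)`_0 * (0`! * l`! * 2 ^ l)%:R)).
    by rewrite !factS !expnS !natrM; ring.
  by rewrite H [k.+2`!]factS [k.+1`!]factS !natrM kE exprS; ring.
have H1 := IH k.+1 (ltnSn _) i l.+1 ltac:(lia).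
have H0 := IH k (ltnW (ltnSn _)) i.+1 l ltac:(lia).
have kE : k.+2%:R = i.+1%:R + 2 * l.+1%:R :> int.
  by rewrite -natrM -natrD; congr _%:R; lia.
transitivity (i.+1%:R * ((He k.+1)`_i * (i`! * (l.+1)`! * 2 ^ l.+1)%:R)
  - k.+1%:R * (2 * l.+1%:R) * ((He k)`_i.+1 * (i.+1`! * l`! * 2 ^ l)%:R)).
  by rewrite !factS !expnS !natrM; ring.
by rewrite H1 H0 [k.+2`!]factS [k.+1`!]factS !natrM kE exprS; ring.
Qed.

(** * Valuations of factorials and of Hermite coefficients *)

Lemma logn_fact_rec p n : prime p -> logn p n`! = (n %/ p + logn p (n %/ p)`!)%N.
Proof.
move=> pp; case: n => [|n]; first by rewrite div0n fact0 logn1.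
rewrite logn_fact // (@logn_fact_sum p (n.+1 %/ p) n) //; last first.
  by rewrite -ltnS ltn_Pdiv ?prime_gt1.
rewrite big_ltn // expn1; congr addn.
by rewrite big_add1; apply: eq_bigr => t _; rewrite expnS divnMA.
Qed.

Lemma logn_fact_lt n p : prime p -> (0 < n)%N -> (p.-1 * logn p n`! < n)%N.
Proof.
move=> pp; elim/ltn_ind: n => n IH n0; rewrite logn_fact_rec //.
have p1 := prime_gt1 pp; have le_n := leq_divM n p.
have [q0|q0] := posnP (n %/ p); first by rewrite q0 fact0 logn1 muln0.
have := IH _ (ltn_Pdiv p1 n0) q0; nia.
Qed.

Lemma logn_fact_small n p : prime p -> (n < p ^ 2)%N -> logn p n`! = (n %/ p)%N.
Proof.
move=> pp lt_n; rewrite logn_fact_rec // logn_fact_rec // [((n %/ p) %/ p)%N]divn_small.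
  by rewrite fact0 logn1 !addn0.
by rewrite ltn_divLR ?prime_gt0.
Qed.

Section HeWeights.
Variable p : nat.
Hypotheses (pp : prime p) (podd : odd p).

Lemma vp_He k i l : (i + l.*2 = k)%N -> (He k)`_i != 0 /\
  (vp p (He k)`_i + logn p i`! + logn p l`! = logn p k`!)%N.
Proof.
move=> /He_coef E; have c0 : (He k)`_i != 0.
  apply/eqP => c0; move/eqP: E; rewrite c0 mul0r eq_sym mulf_eq0 signr_eq0 /=.
  by rewrite pnatr_eq0 eqn0Ngt fact_gt0.
split=> //; move/(congr1 (fun c => logn p `|c|%N)): E.
rewrite !abszM abszX exp1n mul1n !natz !absz_nat.
rewrite lognM ?absz_gt0 ?muln_gt0 ?fact_gt0 ?expn_gt0 //.
rewrite !lognM ?muln_gt0 ?fact_gt0 ?expn_gt0 // lognX [logn p 2]logn_prime //.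
have -> : (p == 2) = false by apply/eqP => p2; move: podd; rewrite p2.
by rewrite muln0 addn0 addnA => <-.
Qed.

Lemma He_poly_above A B w i0 k :
  (forall i l, (i + l.*2)%N = k -> above p A B w i0 i (He k)`_i) ->
  poly_above p A B w i0 (He k).
Proof.
move=> h t; have [odd_kt|] := boolP (odd (k + t)).
  by rewrite He_coef_parity ?above0.
have [le_tk|lt_kt] := leqP t k => even_kt; last first.
  by rewrite nth_default ?size_He ?above0.
by apply: (h t (k - t)./2); lia.
Qed.

(* Below p^2, the valuation of m! is the leading base-p digit a of m. *)
Lemma vp_He_digits a j i l : (j < p)%N -> (a * p + j < p ^ 2)%N ->
  (i + l.*2 = a * p + j)%N -> (He (a * p + j))`_i != 0 /\
  (vp p (He (a * p + j))`_i + i %/ p + l %/ p = a)%N.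
Proof.
move=> jp m2 E; have [c0 v] := vp_He E; split=> //; move: v.
rewrite [logn p (a * p + j)`!]logn_fact_small // divnMDl ?prime_gt0 //.
rewrite [(j %/ p)%N]divn_small // addn0 [logn p i`!]logn_fact_small //; last by lia.
by rewrite [logn p l`!]logn_fact_small //; lia.
Qed.

(** Bounds for the forms [2 p v + i] and [2 p v + 2 i] at a coefficient of index [i] and valuation
    [v]; the equality case of the first one locates the initial term. *)
Lemma digit_bounds a j i l v : (j < p)%N -> (i + l.*2 = a * p + j)%N ->
  (v + i %/ p + l %/ p = a)%N ->
  [/\ (i %/ p + (l %/ p).*2 <= a)%N, (p * a <= 2 * p * v + i)%N,
      (p * a = 2 * p * v + i)%N -> i = (i %/ p * p)%N /\ j = (l - l %/ p * p).*2 &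
      (p * a <= p * v + p * (l %/ p) + i)%N].
Proof.
move=> jp E; have := leq_divM i p; have := leq_divM l p.
move: (i %/ p)%N (l %/ p)%N => q s le_s le_q v_eq.
have le_a : (q + s.*2 <= a)%N.
  by rewrite -ltnS -(@ltn_pmul2r p) ?prime_gt0 //; lia.
have e1 : (p * v + p * q + p * s = p * a)%N by rewrite -!mulnDr v_eq.
have e2 : (p * q + 2 * (p * s) <= p * a)%N.
  by rewrite mulnCA -mulnDr leq_mul2l mul2n le_a orbT.
rewrite -!mulnA; move: e1 e2 le_s le_q E; rewrite ![(_ * p)%N]mulnC.
move: (p * v)%N (p * q)%N (p * s)%N (p * a)%N => pv pq ps pa *.
by split=> //; lia.
Qed.

Lemma He_above_2p_odd a j : (j < p)%N -> (a * p + j < p ^ 2)%N -> odd j ->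
  poly_above p (2 * p) 1 (p * a).+1 0 (He (a * p + j)).
Proof.
move=> jp m2 jo; apply: He_poly_above => i l E.
have [c0 v] := vp_He_digits jp m2 E.
have [_ le_w eq_w _] := digit_bounds jp E v.
rewrite /above (negPf c0) /= /weight mul1n.
move: (vp p _) le_w eq_w => {}v le_w eq_w.
suff : (p * a)%N != (2 * p * v + i)%N by lia.
by apply/eqP => /eq_w [_ jE]; move: jo; rewrite jE odd_double.
Qed.

(** The minimum [p * a] can only be attained at a multiple of [p] having the parity of [a]; the
    first candidate is [0] or [p], and it does attain it. *)
Lemma He_initial_2p_even a j : (j < p)%N -> (a * p + j < p ^ 2)%N -> ~~ odd j ->
  initial p (2 * p) 1 (p * a) (if odd a then p else 0%N) (He (a * p + j)).
Proof.
move=> jp m2 je; have p0 := prime_gt0 pp; split.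
  apply: He_poly_above => i l E.
  have [c0 v] := vp_He_digits jp m2 E.
  have [_ le_w eq_w _] := digit_bounds jp E v.
  rewrite /above (negPf c0) /= /weight mul1n.
  move: (vp p _) le_w eq_w => {}v le_w eq_w.
  have [//|ne_w] := boolP (p * a < _)%N.
  have {}eq_w := eq_w ltac:(lia); case: ifP => ao; last by lia.
  have [le_pi|lt_ip] := leqP p i; first by lia.
  have i0 : i = 0%N by case: eq_w => + _; rewrite divn_small.

  have : odd (a * p + j) by rewrite oddD oddM ao podd (negPf je).
  by rewrite -E i0 add0n odd_double.
set L := (if _ then _ else _).
have [l E] : exists l, (L + l.*2 = a * p + j)%N.
  exists (a * p + j - L)./2.
  have : (L <= a * p + j)%N by rewrite /L; case: a {m2 L} => [|a] //; case: ifP => // _; nia.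
  have : odd L = odd (a * p + j).
    by rewrite oddD oddM podd andbT (negPf je) addbF /L; case: (odd a).
  lia.
have [c0 v] := vp_He_digits jp m2 E.
rewrite /above (negPf c0) /= /weight ltnn andbF orbF -leqNgt.
have lE : (l %/ p)%N = a./2.
  rewrite (_ : l = a./2 * p + j./2)%N; first by rewrite divnMDl // divn_small ?addn0 //; lia.
  have aE := odd_double_half a; move: E; rewrite -{1}aE mulnDl -doubleMl.
  by rewrite /L; case: (odd a) => /=; lia.
have LE : (L %/ p)%N = odd a by rewrite /L; case: ifP; rewrite ?divnn ?div0n ?p0.
rewrite lE LE in v; move: (vp p _) v => v v_eq.
have {}v_eq : v = a./2 by have := odd_double_half a; lia.
have -> : L = (odd a * p)%N by rewrite /L; case: (odd a); rewrite ?mul1n.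
rewrite v_eq mul1n -{3}(odd_double_half a) mulnDr [(p * odd a)%N]mulnC -muln2; lia.
Qed.

(** When the leading digit of [n] is odd, the polygon of [Pr n] begins with an edge of slope [-2/p];
    this form is adapted to it. *)
Lemma He_above_2p_2 b j : (j < p)%N -> (b.*2.+1 * p + j < p ^ 2)%N ->
  poly_above p (2 * p) 2 (2 * p * b.+1) 0 (He (b.*2.+1 * p + j)).
Proof.
move=> jp m2; have p0 := prime_gt0 pp; apply: He_poly_above => i l E.
have [c0 v] := vp_He_digits jp m2 E.
have [le_a _ _ le_w] := digit_bounds jp E v.
rewrite /above (negPf c0) /= /weight.
have le_sb : (l %/ p <= b)%N by move: (l %/ p)%N (i %/ p)%N le_a {v le_w} => s q; lia.
move: (vp p _) le_w v => v le_w _.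
have : (p * (l %/ p) <= p * b)%N by rewrite leq_mul2l le_sb orbT.
move: le_w; rewrite -!mulnA !mulnS -doubleMr; lia.
Qed.

Lemma He_initial_2p_2 b j : (j < p)%N -> (b.*2.+1 * p + j < p ^ 2)%N -> odd j ->
  initial p (2 * p) 2 (2 * p * b.+1) 0 (He (b.*2.+1 * p + j)).
Proof.
move=> jp m2 jo; have p0 := prime_gt0 pp; split; first exact: He_above_2p_2.
have E : (0 + (b * p + (p + j)./2).*2 = b.*2.+1 * p + j)%N.
  have -> : (b.*2.+1 * p = (b * p).*2 + p)%N by rewrite mulSn -doubleMl addnC.
  have := podd; lia.
have [c0 v] := vp_He_digits jp m2 E.
rewrite /above (negPf c0) /= /weight ltnn andbF orbF -leqNgt.
move: v; rewrite div0n addn0 divnMDl // [(_./2 %/ p)%N]divn_small ?addn0; last by lia.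
move: (vp p _) => v ?; by have -> : v = b.+1 by lia.
Qed.
End HeWeights.

Lemma logn_fact_leq p m n : (m <= n)%N -> (logn p m`! <= logn p n`!)%N.
Proof.
move=> le_mn; apply: dvdn_leq_log; rewrite ?fact_gt0 //.
by rewrite -(bin_fact le_mn) mulnCA dvdn_mulr.
Qed.

Section HeAlpha.
Variable p : nat.
Hypotheses (pp : prime p) (podd : odd p).

Lemma vp_He_low k i l : (i + l.*2 = k)%N ->
  (vp p (He k)`_(odd k) <= vp p (He k)`_i + logn p i`!)%N.
Proof.
move=> E; have [_ v] := vp_He podd E.
have E0 : ((odd k : nat) + k./2.*2 = k)%N by rewrite odd_double_half.
have [_ v0] := vp_He podd E0.
have : (logn p l`! <= logn p (k./2)`!)%N by apply: logn_fact_leq; lia.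
have f0 : logn p (odd k : nat)`! = 0%N by case: (odd k); rewrite ?fact0 /= logn1.
move: v0; rewrite f0 addn0 -v.
by move: (vp p _) (vp p _) => x y; lia.
Qed.

Lemma He_weight_low k i l M : (i + l.*2 = k)%N -> (0 < i)%N -> (k <= M)%N ->
  (p.-1 * M * vp p (He k)`_(odd k) <= weight p (p.-1 * M) M.-1 (He k)`_i i)%N.
Proof.
move=> E i0 le_kM; have le_v := vp_He_low E.
have lt_i := logn_fact_lt pp i0.
rewrite /weight; move: (vp p (He k)`_(odd k)) (vp p (He k)`_i) (logn p i`!) le_v lt_i => u v f le_v lt_i.
apply: (@leq_trans (p.-1 * M * (v + f))); first by rewrite leq_mul2l le_v orbT.
rewrite mulnDr leq_add2l mulnAC.
apply: (@leq_trans (i.-1 * M)); first by rewrite leq_mul2r; apply/orP; right; lia.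
nia.
Qed.

Lemma He_initial_low k M : ~~ odd k -> (k <= M)%N ->
  initial p (p.-1 * M) M.-1 (p.-1 * M * vp p (He k)`_0) 0 (He k).
Proof.
move=> ke le_kM; split.
  apply: He_poly_above => // i l E; case: i E => [|i] E.
    by rewrite /above /weight muln0 addn0 eqxx !orbT.
  have := He_weight_low E isT le_kM; rewrite (negPf ke) /above leq_eqVlt.
  by case/orP=> ->; rewrite ?orbT.
have [c0 _] := vp_He podd (odd_double_half k); rewrite (negPf ke) /= in c0.
by rewrite /above (negPf c0) /weight muln0 addn0 !ltnn eqxx.
Qed.

Lemma He_above_low k M : odd k -> (k <= M)%N ->
  poly_above p (p.-1 * M) M.-1 (p.-1 * M * vp p (He k)`_1) 1 (He k).
Proof.
move=> ko le_kM; apply: He_poly_above => // i l E.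
have i0 : (0 < i)%N by case: i E => // E; move: ko; rewrite -E add0n odd_double.
have := He_weight_low E i0 le_kM; rewrite ko /above i0 andbT leq_eqVlt.
by case/orP=> ->; rewrite ?orbT.
Qed.

End HeAlpha.

(** * Hermite polynomials modulo an odd prime *)

Definition mod_poly p (f : {poly int}) : {poly 'F_p} := map_poly intr f.

Section HeModp.
Variable p : nat.
Hypotheses (pp : prime p) (podd : odd p).
Local Notation modp := (mod_poly p).

Lemma Fp_eq0 (c : int) : (c%:~R == 0 :> 'F_p) = (p %| c)%Z.
Proof. by rewrite (dvdz_pcharf (pchar_Fp pp)). Qed.

(** The derivative of [He p] is a multiple of [p], which kills the coefficients of index strictly
    between 0 and [p]; the constant one vanishes by parity. *)
Lemma He_modp : modp (He p) = 'X^p.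
Proof.
apply/polyP => i; rewrite coef_map coefXn.
have [lt_ip|lt_pi|->] := ltngtP i p.
- case: i lt_ip => [|i] lt_ip; first by rewrite He_coef_parity ?addn0 ?rmorph0.
  have /(congr1 (fun f : {poly int} => f`_i)) := deriv_HeS p.-1.
  rewrite prednK ?prime_gt0 // coef_deriv coefZ => E.
  apply/eqP; rewrite Fp_eq0.
  have : (p %| (He p)`_i.+1 *+ i.+1)%Z by rewrite E natz dvdz_mulr.
  rewrite -mulr_natr natz !dvdzE abszM Euclid_dvdM // => /orP[//|].
  by rewrite gtnNdvd.
- by rewrite nth_default ?size_He // rmorph0.
have := He_monic p; rewrite monicE lead_coefE size_He /= => /eqP ->.
by rewrite rmorph1.
Qed.

Lemma modp_HeS k : modp (He k.+2) = 'X * modp (He k.+1) - k.+1%:R *: modp (He k).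
Proof.
rewrite HeS /mod_poly rmorphB rmorphM /= map_polyX -!mul_polyC rmorphM /=.
by rewrite map_polyC /= rmorph_nat.
Qed.

(** Modulo [p] the recurrence has the same coefficients at [p + m] as at [m]. *)
Lemma He_modpD m : modp (He (p + m)) = 'X^p * modp (He m).
Proof.
elim/ltn_ind: m => -[_|[_|m IH]].
- by rewrite addn0 He_modp [He 0]/= /mod_poly rmorph1 mulr1.
- have := modp_HeS p.-1; rewrite prednK ?prime_gt0 // addn1 => ->.
  by rewrite He_modp pchar_Fp_0 // scale0r subr0 mulrC [He 1]/= /mod_poly map_polyX.
rewrite !addnS modp_HeS -!addnS !IH // modp_HeS mulrBr scalerAr mulrCA.
by rewrite natrD pchar_Fp_0 // add0r.
Qed.

Lemma He_modpMD a m : modp (He (a * p + m)) = 'X^(a * p) * modp (He m).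
Proof.
elim: a => [|a IH]; first by rewrite mul0n add0n mul1r.
by rewrite mulSn -addnA He_modpD IH mulrA exprD.
Qed.
End HeModp.

Section HeT0.
Variable p : nat.
Hypotheses (pp : prime p) (podd : odd p).

Lemma above_dvd c A B t i0 : (0 < A)%N -> (p %| c)%Z -> above p A B 0 i0 t c.
Proof.
move=> A0 pc; rewrite /above; have [//|c0] := eqVneq c 0.
rewrite /weight /= addn_gt0 muln_gt0 A0 /vp logn_gt0 mem_primes pp absz_gt0 c0.
by move: pc; rewrite dvdzE /= => ->.
Qed.

Lemma vp_ndvd c : ~~ (p %| c)%Z -> vp p c = 0%N.
Proof. by rewrite dvdzE => pc; apply: logn_coprime; rewrite prime_coprime. Qed.

Lemma He_coef_modp a j t : (((He (a * p + j))`_t)%:~R : 'F_p) =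
  if (t < a * p)%N then 0 else ((He j)`_(t - a * p))%:~R.
Proof.
have /(congr1 (fun f : {poly 'F_p} => f`_t)) := He_modpMD pp podd a j.
by rewrite coefXnM !coef_map.
Qed.

Lemma He_coef0_ndvd j : (j < p)%N -> ~~ odd j -> ~~ (p %| (He j)`_0)%Z.
Proof.
move=> jp je; apply/negP => pc.
have E : (0 + j./2.*2 = j)%N by rewrite add0n -[RHS]odd_double_half (negPf je).
have /(congr1 (fun c => p %| c)%Z) := He_coef E.
rewrite dvdz_mulr // dvdzE abszMsign natz absz_nat => /esym/(prime_dvd_fact pp).
by rewrite leqNgt jp.
Qed.

(** With [B = 0] only the valuation counts, so the initial term is the first coefficient prime to
    [p]; [A = 2] anticipates the halving in [initial_even]. *)
Lemma He_initial_modp a j : (j < p)%N -> ~~ odd j ->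
  initial p 2 0 0 (a * p) (He (a * p + j)).
Proof.
move=> jp je; have apE : ~~ (p %| (He (a * p + j))`_(a * p))%Z.
  rewrite -Fp_eq0 // He_coef_modp ltnn subnn Fp_eq0 //; exact: He_coef0_ndvd.
split=> [t|].
  have [le_t|lt_t] := leqP (a * p) t.
    rewrite /above /weight mul0n addn0 le_t andbT.
    by case: (posnP (2 * _)) => [->|_]; rewrite ?orbT.
  by apply: above_dvd; rewrite // -Fp_eq0 // He_coef_modp lt_t.
rewrite /above /weight vp_ndvd // ltnn !muln0 /=.
by rewrite mul0n ltnn !orbF; apply: contra apE => /eqP->; rewrite dvdz0.
Qed.

Lemma He_above_modp a j : odd j -> poly_above p 2 0 0 (a * p).+1 (He (a * p + j)).
Proof.
move=> jo t; have [lt_t|le_t] := ltnP (a * p) t.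
  rewrite /above /weight mul0n addn0 lt_t andbT.
  by case: (posnP (2 * _)) => [->|_]; rewrite ?orbT.
apply: above_dvd; rewrite // -Fp_eq0 // He_coef_modp.
case: ltnP => // ge_t; rewrite (_ : (t - a * p)%N = 0%N); last by lia.
by rewrite He_coef_parity ?addn0.
Qed.
End HeT0.

(** * The Wronskian of two consecutive Hermite polynomials *)

Definition Wr n : {poly int} :=
  n.+1%:R *: He n ^+ 2 + He n.+1 ^+ 2 - 'X * He n * He n.+1.

Lemma Wr_coef_odd n i : odd i -> (Wr n)`_i = 0.
Proof.
have parM (f g : {poly int}) s t : (forall i, odd (s + i) -> f`_i = 0) ->
    (forall i, odd (t + i) -> g`_i = 0) -> forall i, odd (s + t + i) -> (f * g)`_i = 0.
  move=> hf hg m om; rewrite coefM big1 // => -[j /= lt_j] _.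
  have [o|e] := boolP (odd (s + j)); first by rewrite hf ?mul0r.
  by rewrite (hg (m - j)%N) ?mulr0 //; lia.
have hp k := @He_coef_parity k.
have hX m : odd (1 + m) -> ('X : {poly int})`_m = 0 by rewrite coefX; case: m => [|[|]].
move=> oi; rewrite coefB coefD coefZ !expr2.
rewrite (parM _ _ _ _ (hp n) (hp n)); last by lia.
rewrite (parM _ _ _ _ (hp n.+1) (hp n.+1)); last by lia.
rewrite (parM _ _ _ _ (parM _ _ _ _ hX (hp n)) (hp n.+1)); last by lia.
by rewrite mulr0 addr0 subr0.
Qed.

Definition Pr n : {poly int} := even_poly (Wr n).

Lemma Wr_even n : Wr n = Pr n \Po 'X^2.
Proof.
rewrite -[LHS]poly_even_odd [odd_poly _](_ : _ = 0) ?comp_poly0 ?mul0r ?addr0 //.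
by apply/polyP => i; rewrite coef_odd_poly Wr_coef_odd ?coef0 //= odd_double.
Qed.

Lemma Wr_coef_double n i : (Wr n)`_i.*2 = (Pr n)`_i.
Proof. by rewrite coef_even_poly. Qed.

(** * Newton polygon of the Wronskian *)

Section WrInitial.
Variables (p A B n w i : nat).
Hypotheses (pp : prime p) (pn : ~~ (p %| n.+1)%N).

Lemma poly_above_X : poly_above p A B 0 1 'X.
Proof.
move=> t; rewrite coefX; case: eqP => [->|_]; last exact: above0.
by rewrite /above; case: (posnP (weight _ _ _ _ _)) => [->|_]; rewrite ?orbT.
Qed.

Lemma initial_unit_scale (f : {poly int}) u j : initial p A B u j f ->
  initial p A B u j (n.+1%:R *: f).
Proof.
have v0 : vp p n.+1%:R = 0%N by apply: vp_ndvd => //; rewrite natz dvdzE.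
have n0 : n.+1%:R != 0 :> int by rewrite pnatr_eq0.
have E a0 t c : above p A B u a0 t (n.+1%:R * c) = above p A B u a0 t c.
  rewrite /above mulf_eq0 (negPf n0) /=; case: (eqVneq c 0) => //= c0.
  by rewrite /weight vpM // v0.
by case=> h1 h2; split=> [t|]; rewrite coefZ E.
Qed.

(** The square of [He n] dominates, [n.+1] being prime to [p]; the factor ['X] pushes the cross term
    to a later index. *)
Lemma Wr_initial_left : initial p A B w i (He n) ->
  poly_above p A B w i.+1 (He n.+1) -> initial p A B w.*2 i.*2 (Wr n).
Proof.
move=> hf hg; have af := proj1 hf; have hX := poly_above_X.
rewrite /Wr -!addnn -addrA !expr2; apply: initialD => //.
  exact/initial_unit_scale/initialM.
apply: poly_aboveD => //.
  by apply: (poly_above_le pp (poly_aboveM pp hg hg)); rewrite eqxx; lia.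
apply: poly_aboveN.
apply: (poly_above_le pp (poly_aboveM pp (poly_aboveM pp hX af) hg)).
by rewrite eqxx; lia.
Qed.

Lemma Wr_initial_right : poly_above p A B w i.+1 (He n) ->
  initial p A B w i (He n.+1) -> initial p A B w.*2 i.*2 (Wr n).
Proof.
move=> af hg; have hX := poly_above_X; have ag := proj1 hg.
have -> : Wr n = He n.+1 ^+ 2 + (n.+1%:R *: (He n * He n) - 'X * He n * He n.+1).
  by rewrite /Wr expr2; ring.
rewrite -!addnn expr2; apply: initialD => //; first exact: initialM.
apply: poly_aboveD => //.
  have := poly_aboveM pp af af; move: (He n * He n) => q hq t.
  rewrite coefZ; have : above p A B (0 + (w + w)) (0 + (i + i).+1) (0 + t) (n.+1%:R * q`_t).
    apply: aboveM => //.
      by rewrite /above; case: (posnP (weight _ _ _ _ _)) => [->|_]; rewrite ?eqxx ?orbT.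
    by apply: (above_le pp (hq t)); rewrite eqxx; lia.
  by rewrite !add0n.
apply: poly_aboveN.
apply: (poly_above_le pp (poly_aboveM pp (poly_aboveM pp hX af) ag)).
by rewrite eqxx; lia.
Qed.
End WrInitial.

(** Passing to the variable [x^2] halves the indices, so doubling [A] keeps the slopes matched. *)
Lemma initial_even p A B w i n : initial p (2 * A) B w.*2 i.*2 (Wr n) ->
  initial p A B w i (Pr n).
Proof.
have E w' i' t c : above p (2 * A) B w'.*2 i' t.*2 c = above p A B w' (uphalf i') t c.
  rewrite /above /weight; case: eqP => //= _.
  have -> : (2 * A * vp p c + B * t.*2 = (A * vp p c + B * t).*2)%N.
    by rewrite doubleD -mulnA mul2n -doubleMr.
  by rewrite ltn_double (inj_eq double_inj) leq_uphalf_double.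
case=> h1 h2; split=> [t|].
  by move: (h1 t.*2); rewrite E Wr_coef_double uphalf_double.
by move: h2; rewrite E Wr_coef_double /= doubleK.
Qed.

Section PrInitial.
Variables (p n : nat).
Hypotheses (pp : prime p) (podd : odd p) (pn : ~~ (p %| n.+1)%N).

Let nE : n = (n %/ p * p + n %% p)%N. Proof. exact: divn_eq. Qed.
Let n1E : n.+1 = (n %/ p * p + (n %% p).+1)%N. Proof. by rewrite addnS -nE. Qed.
Let HnE : He n = He (n %/ p * p + n %% p). Proof. by rewrite -nE. Qed.
Let Hn1E : He n.+1 = He (n %/ p * p + (n %% p).+1). Proof. by rewrite -n1E. Qed.
Let jp : ((n %% p).+1 < p)%N.
Proof.
rewrite ltn_neqAle ltn_pmod ?prime_gt0 // andbT; apply: contra pn => /eqP j1.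
by rewrite n1E j1 dvdn_add // dvdn_mull.
Qed.
Let jp' : (n %% p < p)%N. Proof. exact: ltnW. Qed.

(** Of [He n] and [He n.+1], the one whose last base [p] digit is even dominates. *)
Lemma Pr_initial_modp : initial p 1 0 0 (n %/ p * p) (Pr n).
Proof.
apply: (@initial_even _ 1 0 0); have [jo|je] := boolP (odd (n %% p)).
  apply: (@Wr_initial_right _ _ _ _ 0) => //; first by rewrite HnE; apply: He_above_modp.
  by rewrite Hn1E; apply: He_initial_modp; rewrite //= jo.
apply: (@Wr_initial_left _ _ _ _ 0) => //; first by rewrite HnE; apply: He_initial_modp.
by rewrite Hn1E; apply: He_above_modp.
Qed.

Section Digits.
Hypothesis n2 : (n.+1 < p ^ 2)%N.
Let n2a : (n %/ p * p + n %% p < p ^ 2)%N. Proof. by rewrite -nE ltnW. Qed.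
Let n2b : (n %/ p * p + (n %% p).+1 < p ^ 2)%N. Proof. by rewrite -n1E. Qed.

(** The supporting line of slope [-1/p]. When [n %/ p] is odd it is first met at index [p], after an
    edge of slope [-2/p] given by [Pr_initial_p2]. *)
Lemma Pr_initial_p1 : initial p p 1 (p * (n %/ p))
  (if odd (n %/ p) then p else 0%N) (Pr n).
Proof.
apply: initial_even; have [jo|je] := boolP (odd (n %% p)).
  apply: Wr_initial_right => //; last by rewrite Hn1E; apply: He_initial_2p_even; rewrite //= jo.
  rewrite HnE; apply: (poly_above_le pp (He_above_2p_odd pp podd jp' n2a jo)).
  by rewrite ltnSn.
apply: Wr_initial_left => //; first by rewrite HnE; apply: He_initial_2p_even.
rewrite Hn1E; apply: (poly_above_le pp (He_above_2p_odd pp podd jp n2b _)) => //.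
by rewrite ltnSn.
Qed.

Lemma poly_above_coef0 A B w f : poly_above p A B w 0 f -> f`_0 = 0 ->
  poly_above p A B w 1 f.
Proof. by move=> h f0 [|t]; [rewrite f0 above0 | have := h t.+1; rewrite /above]. Qed.

Lemma Pr_initial_p2 : odd (n %/ p) -> initial p p 2 (p * (n %/ p).+1) 0 (Pr n).
Proof.
move=> ao; set b := (n %/ p)./2.
have aE : (n %/ p)%N = b.*2.+1 by rewrite -[LHS]odd_double_half ao.
rewrite aE -doubleS -mul2n mulnCA mulnA.
apply: initial_even; have [jo|je] := boolP (odd (n %% p)).
  apply: (@Wr_initial_left _ _ _ _ _ 0) => //.
    by rewrite HnE aE; apply: He_initial_2p_2; rewrite -?aE.
  rewrite Hn1E aE; apply: poly_above_coef0; first by apply: He_above_2p_2; rewrite -?aE.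
  by rewrite He_coef_parity // -aE -n1E; move: nE ao jo podd; lia.
apply: (@Wr_initial_right _ _ _ _ _ 0) => //.
  rewrite HnE aE; apply: poly_above_coef0; first by apply: He_above_2p_2; rewrite -?aE.
  by rewrite He_coef_parity // addn0 oddD oddM podd /= odd_double (negPf je).
by rewrite Hn1E aE; apply: He_initial_2p_2; rewrite -?aE //= je.
Qed.
End Digits.

(** Every slope of the polygon is at least [-(2n - 1) / ((p - 1) n)]. This is the low-order estimate
    with [M = 2 * n], which bounds both [n] and [n.+1]. *)
Lemma Pr_initial_low : (0 < n)%N ->
  exists w, initial p (p.-1 * n) (2 * n).-1 w 0 (Pr n).
Proof.
move=> n0; have AE : (2 * (p.-1 * n) = p.-1 * (2 * n))%N by rewrite mulnCA.
have [no|ne] := boolP (odd n).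
  exists (p.-1 * (2 * n) * vp p (He n.+1)`_0)%N.
  apply: initial_even; rewrite AE; apply: (@Wr_initial_right _ _ _ _ _ 0) => //.
    have -> : vp p (He n.+1)`_0 = vp p (He n)`_1.
      have := deriv_He n => /(congr1 (fun f : {poly int} => f`_0)).
      rewrite coef_deriv coefB coefXM /= mulr1n sub0r => ->.
      by rewrite /vp abszN.
    by apply: He_above_low => //; lia.
  by apply: He_initial_low; rewrite //= ?no //; lia.
exists (p.-1 * (2 * n) * vp p (He n)`_0)%N.
apply: initial_even; rewrite AE; apply: (@Wr_initial_left _ _ _ _ _ 0) => //.
  by apply: He_initial_low => //; lia.
have [c0 _] := vp_He podd (odd_double_half n); rewrite (negPf ne) /= in c0.
have <- : vp p (He n.+1)`_1 = vp p (He n)`_0.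
  have := deriv_HeS n => /(congr1 (fun f : {poly int} => f`_0)).
  rewrite coef_deriv coefZ mulr1n => ->; rewrite vpM //; last by rewrite pnatr_eq0.
  by rewrite vp_ndvd // natz dvdzE.
by apply: He_above_low => //; lia.
Qed.

(** * Degrees of factors of [Pr n] *)

Section Factor.
Variables (D E : {poly int}) (d e : nat).
Hypotheses (DE : D * E = Pr n) (sD : size D = d.+1) (sE : size E = e.+1).
Hypotheses (dn : (d + e = n)%N) (Dmon : D \is monic).

(** Modulo [p], [Pr n] is [y^(n %/ p * p)] times a polynomial of degree [n %% p] that does not
    vanish at 0; [u] and [v] are the shares of the power of [y]. *)
Lemma factor_modp : exists u v, [/\ initial p 1 0 0 u D, initial p 1 0 0 v E,
  (u + v = n %/ p * p)%N, (u <= d)%N & (d - u <= n %% p)%N].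
Proof.
have := Pr_initial_modp; rewrite -DE => /initial_factor-/(_ pp).
case=> w1 [u [w2 [v [hD hE /esym/eqP]]]].
rewrite addn_eq0 => /andP[/eqP w10 /eqP w20] uv; rewrite {}w10 {}w20 in hD hE.
have le_coef (f : {poly int}) m t : size f = m.+1 -> f`_t != 0 -> (t <= m)%N.
  by move=> sf; rewrite -ltnS -sf; apply: contraR; rewrite -leqNgt => /(nth_default 0)->.
have le_u := le_coef _ _ _ sD (proj1 (initial_neq0 pp hD)).
have le_v := le_coef _ _ _ sE (proj1 (initial_neq0 pp hE)).
by exists u, v; split=> //; move: nE; lia.
Qed.

(** If [u > 0], then [p] divides [D(0)], and the slope bound gives [(p - 1) n <= (2n - 1) d],
    impossible for [2d < p]. So [u = 0]. *)
Lemma factor_degree_low : (0 < n)%N -> (0 < d)%N -> (d.*2 < p)%N -> (d <= n %% p)%N.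
Proof.
move=> n0 d0 dp; have [u [v [hD hE _ le_ud le_du]]] := factor_modp.
have [u0|u0] := posnP u; first by rewrite u0 subn0 in le_du.
have [w] := Pr_initial_low n0; rewrite -DE => /initial_factor-/(_ pp).
case=> w1 [i1 [w2 [i2 [lD lE _ /esym/eqP]]]].
rewrite addn_eq0 => /andP[/eqP i10 _]; rewrite {}i10 in lD.
have [D0 wE] := initial_neq0 pp lD.
have lcD : D`_d = 1 by move: Dmon; rewrite monicE lead_coefE sD => /eqP.
have := initial_le lD (_ : D`_d != 0); rewrite lcD => /(_ isT).
rewrite -wE /weight muln0 addn0 [vp p 1]logn1 muln0 add0n.
have v0 : (0 < vp p D`_0)%N.
  case: hD => /(_ 0%N); rewrite /above (negPf D0) /weight (leqNgt u) u0 andbF orbF.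
  by rewrite mul1n mul0n addn0.
move=> le_w; suff : (2 * n * d <= (2 * n).-1 * d)%N.
  by rewrite leq_pmul2r //; lia.
apply: leq_trans le_w; apply: leq_trans (leq_pmulr _ v0).
by rewrite mulnAC mul2n leq_mul2r; apply/orP; right; lia.
Qed.

(** It suffices that [p] divides [u], the minimum of [p * v + t] over the coefficients of [D], with
    [v] the valuation and [t] the index. For [n %/ p] even the minimum is attained at index 0;
    otherwise it is first attained at the end [i1] of the edge of slope [-2/p], and [p] divides
    [2 * i1]. *)
Lemma factor_degree_mod : (n.+1 < p ^ 2)%N -> (d %% p <= n %% p)%N.
Proof.
move=> n2; have [u [v [hD hE uv le_ud le_du]]] := factor_modp.
suff pu : (p %| u)%N.
  rewrite -(subnKC le_ud) -modnDml (eqP pu) add0n modn_small //.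
  exact: leq_ltn_trans le_du jp'.
have := Pr_initial_p1 n2; rewrite -DE => /initial_factor-/(_ pp).
case=> w1 [i1 [w2 [i2 [lD lE ww ii]]]].
have [Du wDu] := initial_neq0 pp hD; have [Ev wEv] := initial_neq0 pp hE.
have vu : vp p D`_u = 0%N by move: wDu; rewrite /weight; lia.
have vv : vp p E`_v = 0%N by move: wEv; rewrite /weight; lia.
have w1u : w1 = u.
  have := initial_le lD Du; have := initial_le lE Ev.
  by rewrite /weight vu vv; move: ww uv; rewrite mulnC; lia.
have w2v : w2 = v by move: ww uv; rewrite w1u mulnC; lia.
have [D1 wD1] := initial_neq0 pp lD; have [E1 wE1] := initial_neq0 pp lE.
case: ifP ii => ao ii.
  have := Pr_initial_p2 n2 ao; rewrite -DE => /initial_factor-/(_ pp).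
  case=> w1' [i1' [w2' [i2' [kD kE ww' /esym/eqP]]]].
  rewrite addn_eq0 => /andP[/eqP i10 /eqP i20]; rewrite {}i10 {}i20 in kD kE.
  have [D0 wD0] := initial_neq0 pp kD; have [E0 wE0] := initial_neq0 pp kE.
  have := initial_le kD D1; have := initial_le kE E1.
  move: wD1 wE1 wD0 wE0; rewrite /weight !mul1n !muln0 !addn0 w1u w2v.
  move: (vp p D`_i1) (vp p E`_i2) (vp p D`_0) (vp p E`_0) => a1 a2 a3 a4.
  move=> e1 e2 e3 e4 le2 le1.
  (* The corresponding inequalities for [D] and [E] add up to an equality, so each is one. *)
  have e5 : w1' = (u + i1)%N.
    move: ww' uv ii e1 e2 le1 le2; rewrite mulnS mulnC.
    by move: (p * a1)%N (p * a2)%N (n %/ p * p)%N; clear; lia.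
  have p2i : (p %| 2 * i1)%N.
    have pE : (p * a1 + 2 * i1 = p * a3)%N.
      by move: e1 e3 e5; move: (p * a1)%N (p * a3)%N; clear; lia.
    by rewrite -(@dvdn_addr (p * a1)) ?dvdn_mulr // pE dvdn_mulr.
  have pi : (p %| i1)%N.
    move: p2i; rewrite Euclid_dvdM // => /orP[|//].
    by rewrite dvdn_prime2 // => /eqP p2; move: podd; rewrite p2.
  by rewrite -e1 dvdn_add // dvdn_mulr.
have i10 : i1 = 0%N by lia.
by rewrite -w1u -wD1 i10 /weight muln0 addn0 dvdn_mulr.
Qed.
End Factor.
End PrInitial.

(** * Leading coefficient, constant coefficient and reduction of the Wronskian *)

Lemma Wr_wronskian n : Wr n = He n * (He n.+1)^`() - He n.+1 * (He n)^`().
Proof. by rewrite deriv_HeS deriv_He /Wr -!mul_polyC; ring. Qed.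

Lemma He_coef_lead k : (He k)`_k = 1.
Proof. by have := He_monic k; rewrite monicE lead_coefE size_He => /eqP. Qed.

Lemma coefM_top (f g : {poly int}) s t : (size f <= s.+1)%N -> (size g <= t.+1)%N ->
  (f * g)`_(s + t) = f`_s * g`_t.
Proof.
move=> sf sg; have lt_s : (s < (s + t).+1)%N by lia.
rewrite coefM (bigD1 (Ordinal lt_s)) //= addKn big1 ?addr0 // => -[j /= lt_j].
rewrite -val_eqE /= => ne_j; have [lt_js|le_sj] := ltnP j s.
  by rewrite [g`_ _]nth_default ?mulr0 //; apply: leq_trans sg _; lia.
rewrite [f`_ _]nth_default ?mul0r //; apply: leq_trans sf _.
by rewrite ltn_neqAle eq_sym ne_j.
Qed.

(** In the form [(n + 1) He_n^2 - He_(n+1) He_n'] the top coefficient is [(n + 1) - n]. *)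
Lemma Wr_coef_top n : (Wr n)`_n.*2 = 1 /\ (size (Wr n) <= (n.*2).+1)%N.
Proof.
have sH k := size_He k; have lH k := He_coef_lead k.
have -> : Wr n = n.+1%:R *: (He n * He n) + He n.+1 * (He n.+1 - 'X * He n).
  by rewrite /Wr !expr2; ring.
have -> : He n.+1 - 'X * He n = - (He n)^`() by rewrite deriv_He opprB.
split.
  rewrite coefD coefZ mulrN coefN -addnn coefM_top ?sH // !lH.
  case: n => [|n]; first by rewrite [He 0]/= derivE mulr0 coef0 subr0.
  rewrite (_ : (n.+1 + n.+1)%N = (n.+2 + n)%N); last by lia.
  rewrite coefM_top ?sH //; last by rewrite deriv_HeS (leq_trans (size_scale_leq _ _)) ?sH.
  by rewrite lH coef_deriv lH !mulr1 mul1r -natrB // subSnn.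
apply: leq_trans (size_polyD _ _) _; rewrite geq_max; apply/andP; split.
  apply: leq_trans (size_scale_leq _ _) _; apply: leq_trans (size_polyMleq _ _) _.
  by rewrite !sH; lia.
rewrite mulrN size_polyN; apply: leq_trans (size_polyMleq _ _) _.
have : (size (He n)^`() <= n)%N by rewrite -ltnS -(sH n) lt_size_deriv // -size_poly_gt0 sH.
by rewrite sH; move: (size _) => s; lia.
Qed.

Lemma Pr_size_monic n : size (Pr n) = n.+1 /\ Pr n \is monic.
Proof.
have [c s] := Wr_coef_top n.
have sP : size (Pr n) = n.+1.
  apply/eqP; rewrite eqn_leq; apply/andP; split.
    by apply: leq_trans (size_even_poly _) _; lia.
  rewrite ltnNge; apply/negP => /(nth_default 0).
  by rewrite -Wr_coef_double c => /eqP; rewrite oner_eq0.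
by rewrite monicE lead_coefE sP /= -Wr_coef_double c.
Qed.

Lemma Wr_coef0_gt0 n : odd n -> 0 < (Wr n)`_0.
Proof.
move=> on; rewrite coefB coefD coefZ !expr2 !coef0M (He_coef_parity (_ : odd (n + 0))); last by rewrite addn0.
rewrite !mulr0 mul0r add0r subr0 -expr2 exprn_even_gt0 //=.
have E : (0 + (n.+1)./2.*2 = n.+1)%N by lia.
(* The prime 3 is an arbitrary odd prime; only the nonvanishing of the coefficient is taken. *)
by have [] := @vp_He 3 isT _ _ _ E.
Qed.

Lemma modp_Wr p a j : prime p -> odd p ->
  mod_poly p (Wr (a * p + j)) = 'X^((a * p).*2) * mod_poly p (Wr j).
Proof.
move=> pp po; have h := He_modpMD pp po.
have mapW m : mod_poly p (Wr m) = m.+1%:R *: mod_poly p (He m) ^+ 2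
   + mod_poly p (He m.+1) ^+ 2 - 'X * mod_poly p (He m) * mod_poly p (He m.+1).
  rewrite /mod_poly /Wr rmorphB rmorphD !rmorphM /= map_polyX -!mul_polyC rmorphM /=.
  by rewrite map_polyC /= rmorph_nat !expr2 !rmorphM.
rewrite !mapW -addnS !h -addnn exprD addnS -[in X in X *: _]addnS natrD natrM pchar_Fp_0 //.
rewrite mulr0 add0r -!mul_polyC; ring.
Qed.

Lemma even_poly_comp (R : comNzRingType) (f : {poly R}) : even_poly (f \Po 'X^2) = f.
Proof.
apply/polyP => i; rewrite coef_even_poly coef_comp_poly_Xn // dvdn2 odd_double.
by rewrite -muln2 mulnK.
Qed.

(* He_k(x) = x^(k mod 2) * half_He (x^2) k *)
Fixpoint half_He (R : comNzRingType) (y : R) k : R :=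
  match k with
  | 0 => 1
  | k'.+1 => if k' is k''.+1
             then (if odd k'' then half_He y k' else y * half_He y k') - k'%:R * half_He y k''
             else 1
  end.

Lemma half_HeS (R : comNzRingType) (y : R) k : half_He y k.+2 =
  (if odd k then half_He y k.+1 else y * half_He y k.+1) - k.+1%:R * half_He y k.
Proof. by []. Qed.

Lemma half_HeE k : He k = 'X^(odd k) * half_He 'X^2 k.
Proof.
elim/ltn_ind: k => -[_|[_|k IH]]; rewrite ?mulr1 //.
rewrite HeS half_HeS !IH // -mul_polyC polyC_natr /= negbK.
by case: (odd k) => /=; rewrite ?expr0 ?expr1; ring.
Qed.

Lemma rmorph_half_He (R S : comNzRingType) (h : {rmorphism R -> S}) y k :
  h (half_He y k) = half_He (h y) k.
Proof.
elim/ltn_ind: k => -[_|[_|k IH]]; rewrite ?rmorph1 //.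
by rewrite !half_HeS rmorphB rmorphM rmorph_nat !IH //; case: (odd k); rewrite ?rmorphM !IH.
Qed.

(** [Pr 8] evaluated in an arbitrary ring, so that evaluation at an integer commutes with reduction
    modulo 13. *)
Definition half_Wr8 (R : comNzRingType) (y : R) : R :=
  9%:R * half_He y 8 ^+ 2 + y * half_He y 9 ^+ 2 - y * half_He y 8 * half_He y 9.

Lemma rmorph_half_Wr8 (R S : comNzRingType) (h : {rmorphism R -> S}) y :
  h (half_Wr8 y) = half_Wr8 (h y).
Proof.
by rewrite /half_Wr8 !expr2 rmorphB rmorphD !rmorphM rmorph_nat !rmorph_half_He.
Qed.

Lemma Pr8_no_root (c : int) : ~~ root (Pr 8) c.
Proof.
have -> : Pr 8 = half_Wr8 ('X : {poly int}).
  rewrite -[RHS]even_poly_comp [_ \Po _]rmorph_half_Wr8 /= comp_polyX; congr even_poly.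
  rewrite /Wr !half_HeE /half_Wr8 -mul_polyC polyC_natr [odd 8]/= [odd 9]/=.
  by move: (half_He _ 8) (half_He _ 9) => f g; rewrite expr0 expr1; ring.
rewrite rootE -horner_evalE rmorph_half_Wr8 /= horner_evalE hornerX.
apply/negP => /eqP/(congr1 (intr : int -> 'F_13)).
rewrite rmorph_half_Wr8 rmorph0 /=; move: (c%:~R) => x; apply/eqP; move: x.
by case=> m; do 13?[case: m => [|m] //].
Qed.

(** * Irreducibility of [Pr n] *)

Lemma prime_dvd_ffact p n d : prime p -> (p %| n ^_ d)%N ->
  exists2 j, (j < d)%N & (p %| n - j)%N.
Proof.
move=> pp; elim: d => [|d IH]; first by rewrite ffactn0 Euclid_dvd1.
rewrite ffactnSr Euclid_dvdM // => /orP[/IH[j jd pj]|pj]; last by exists d.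
by exists j; rewrite // ltnS ltnW.
Qed.

(** In Kummer's sum the condition on last digits excludes a carry at [t = 1], and [n < p ^ t]
    excludes one for [t >= 2]. *)
Lemma prime_ndvd_bin_small p n d : prime p -> (n < p ^ 2)%N -> (d <= n)%N ->
  (d %% p <= n %% p)%N -> ~~ (p %| 'C(n, d))%N.
Proof.
move=> pp n2 dn le_mod; suff v0 : logn p 'C(n, d) = 0%N.
  apply/negP => pC; have : (0 < logn p 'C(n, d))%N.
    by rewrite logn_gt0 mem_primes pp bin_gt0 dn.
  by rewrite v0.
rewrite logn_bin // big_nat_cond big1 // => t; rewrite andbT => /andP[t0 _].
apply/eqP; rewrite eqb0 -ltnNge; case: t t0 => // -[|t] _.
  rewrite expn1; have nE : ((n - d) %% p = n %% p - d %% p)%N.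
    have -> : (n - d = (n %/ p - d %/ p) * p + (n %% p - d %% p))%N.
      have le_q := leq_mul (leq_div2r p dn) (leqnn p).
      by rewrite mulnBl; move: le_q (divn_eq n p) (divn_eq d p); lia.
    rewrite modnMDl modn_small //; apply: leq_ltn_trans (leq_subr _ _) _.
    by rewrite ltn_pmod ?prime_gt0.
  by rewrite nE subnKC // ltn_pmod ?prime_gt0.
have le2 : (p ^ 2 <= p ^ t.+2)%N by apply: leq_pexp2l; rewrite ?prime_gt0.
apply: leq_ltn_trans (_ : n < p ^ t.+2)%N; last exact: leq_trans n2 le2.
by rewrite -[X in (_ <= X)%N](subnKC dn) leq_add ?leq_mod.
Qed.

(** A prime [p > 2d] dividing ['C(n, d)] divides some [n - j] with [j < d], so [n %% p = j < d],
    against [factor_degree_low]. A prime [p > k] is prime to [n.+1] and has [n.+1 < p ^ 2], so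
    [factor_degree_mod] rules out carries. *)
Lemma Pr_factor_trivial n k (D E : {poly int}) d e : (0 < n)%N -> n.+1 = (k ^ 2)%N ->
  D * E = Pr n -> D \is monic -> size D = d.+1 -> size E = e.+1 -> (d + e)%N = n ->
  (d <= e)%N -> d = 0%N.
Proof.
move=> n0 nk DE Dm sD sE de le_de; apply/eqP; rewrite -leqn0 leqNgt; apply/negP => d0.
have dn : (d.*2 <= n)%N by lia.
have le_dn : (d <= n)%N by lia.
have k2 : (2 <= k)%N by nia.
have smooth p : prime p -> (p %| 'C(n, d))%N -> (p <= d.*2)%N /\ (p <= k)%N.
  move=> pp pC; have [p2|po] := even_prime pp; first by rewrite p2; lia.
  split; rewrite leqNgt; apply/negP => lt_p.
    have [j jd pj] : exists2 j, (j < d)%N & (p %| n - j)%N.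
      by apply: prime_dvd_ffact => //; rewrite -bin_ffact dvdn_mulr.
    have nmod : (n %% p = j)%N.
      by rewrite -(@subnKC j n) ?modnDr; [rewrite -modnDmr (eqP pj) addn0 modn_small; lia | lia].
    have pn : ~~ (p %| n.+1)%N.
      rewrite /dvdn -addn1 -modnDml nmod modn_small; lia.
    by have := factor_degree_low pp po pn DE sD sE de Dm n0 d0 lt_p; rewrite nmod leqNgt jd.
  have pn : ~~ (p %| n.+1)%N.
    by rewrite nk Euclid_dvdX // andbT gtnNdvd //; lia.
  have np2 : (n.+1 < p ^ 2)%N by rewrite nk ltn_sqr.
  have := factor_degree_mod pp po pn DE sD sE de Dm np2.
  by move/(prime_ndvd_bin_small pp (ltnW np2) le_dn); rewrite pC.
have [n8 d1] := bin_square_pred_smooth nk d0 dn smooth.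
have [c Dc] : exists c, root D c.
  exists (- D`_0); rewrite rootE horner_coef sD d1 !big_ord_recl big_ord0 /=.
  by move: Dm; rewrite monicE lead_coefE sD d1 /= => /eqP ->; rewrite addr0 mul1r mulr1 expr1 subrr.
by have := Pr8_no_root c; rewrite -n8 -DE rootM Dc.
Qed.

Lemma Pr_irreducible n k : (0 < n)%N -> n.+1 = (k ^ 2)%N ->
  irreducible_poly (map_poly intr (Pr n) : {poly rat}).
Proof.
move=> n0 nk; have [sP Pm] := Pr_size_monic n.
split; first by rewrite size_rat_int_poly sP.
move=> q sq qP; rewrite -(dvdp_size_eqp qP) size_rat_int_poly sP.
have [p1 [a a0 qE] [r PE]] := dvdpP_rat_int qP.
rewrite qE size_scale // size_rat_int_poly in sq *.
have lc : lead_coef p1 * lead_coef r = 1 by rewrite -lead_coefM -PE (eqP Pm).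
have lc2 : lead_coef r * lead_coef p1 = 1 by rewrite mulrC.
have p10 : p1 != 0 by rewrite -lead_coef_eq0; apply: contraPneq lc => ->; rewrite mul0r.
have r0 : r != 0 by rewrite -lead_coef_eq0; apply: contraPneq lc => ->; rewrite mulr0.
have scale0 (u v : int) : u * v = 1 -> u != 0 by move=> uv; apply: contraPneq uv => ->; rewrite mul0r.
(* The two leading coefficients are inverse integers, so exchanging them makes both factors
   monic. *)
set D := lead_coef r *: p1; set E := lead_coef p1 *: r.
have DE : D * E = Pr n by rewrite -scalerAl -scalerAr scalerA lc2 scale1r.
have sD : size D = (size p1).-1.+1.
  by rewrite size_scale ?(scale0 _ _ lc2) // prednK // size_poly_gt0.
have sE : size E = (size r).-1.+1.
  by rewrite size_scale ?(scale0 _ _ lc) // prednK // size_poly_gt0.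
have Dm : D \is monic by rewrite monicE lead_coefZ lc2.
have Em : E \is monic by rewrite monicE lead_coefZ lc.
have de : ((size p1).-1 + (size r).-1)%N = n.
  have := sP; rewrite PE size_mul //; move: p10 r0; rewrite -!size_poly_gt0.
  by move: (size p1) (size r); clear; lia.
have [le|/ltnW le] := leqP (size p1).-1 (size r).-1.
  have d0 := Pr_factor_trivial n0 nk DE Dm sD sE de le.
  by move: sq p10 d0; rewrite -size_poly_gt0; move: (size p1); clear; lia.
rewrite mulrC in DE; rewrite addnC in de.
have e0 := Pr_factor_trivial n0 nk DE Em sE sD de le.
move: p10 r0 de; rewrite e0 add0n -!size_poly_gt0 => p1_gt0 _ <-.
by rewrite prednK.
Qed.

(** * Norms from Z[x] to Z[x^2] *)

Definition poly_norm (R : comNzRingType) (A : {poly R}) : {poly R} :=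
  even_poly A ^+ 2 - 'X * odd_poly A ^+ 2.

Lemma poly_norm_comp (R : comNzRingType) (A : {poly R}) :
  poly_norm A \Po 'X^2 = A * (A \Po - 'X).
Proof.
have X2 : 'X^2 \Po (- 'X) = 'X^2 :> {poly R} by rewrite comp_Xn_poly sqrrN.
have -> : A \Po - 'X = (even_poly A \Po 'X^2) - (odd_poly A \Po 'X^2) * 'X.
  rewrite -{1}(poly_even_odd A) comp_polyD comp_polyM -!comp_polyA X2 comp_polyX.
  by rewrite mulrN.
rewrite -{2}(poly_even_odd A) /poly_norm !expr2 comp_polyB !comp_polyM comp_polyX; ring.
Qed.

Lemma size_poly_norm (A : {poly int}) : A != 0 -> size (poly_norm A) = size A.
Proof.
move=> A0; have AN0 : A \Po - 'X != 0.
  by rewrite -size_poly_gt0 size_comp_poly2 ?size_poly_gt0 // size_polyN size_polyX.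
have := congr1 (fun f : {poly int} => size f) (poly_norm_comp A).
have sAN : size (A \Po - 'X) = size A by rewrite size_comp_poly2 // size_polyN size_polyX.
rewrite size_mul // sAN => sN.
have := size_comp_poly (poly_norm A) ('X^2 : {poly int}).
rewrite size_polyXn sN /=; move: sN A0; rewrite -size_poly_gt0.
have [->|N0] := eqVneq (poly_norm A) 0.
  by rewrite comp_poly0 size_poly0; move: (size A); lia.
move: N0; rewrite -size_poly_gt0; move: (size (poly_norm A)) (size A) => a b *; lia.
Qed.

Lemma lead_coef_poly_norm (A : {poly int}) : A != 0 ->
  lead_coef (poly_norm A) = (-1) ^+ (size A).-1 * lead_coef A ^+ 2.
Proof.
move=> A0; have := congr1 lead_coef (poly_norm_comp A).
rewrite lead_coefM !lead_coef_comp ?size_polyXn ?size_polyN ?size_polyX //.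
rewrite lead_coefXn expr1n mulr1 lead_coefN lead_coefX => ->.
by ring.
Qed.

Lemma poly_norm_mul_eq n (A B : {poly int}) : Wr n = A * B ->
  poly_norm A * poly_norm B = Pr n ^+ 2.
Proof.
move=> WE; rewrite -[LHS]even_poly_comp -[RHS]even_poly_comp; congr even_poly.
rewrite rmorphM rmorphXn /= !poly_norm_comp -Wr_even mulrACA -comp_polyM -WE expr2.
congr (_ * _); rewrite Wr_even -comp_polyA comp_Xn_poly sqrrN //.
Qed.

(** Otherwise [x = s / t] has [x^2 = -1], and [p = 4q + 3] gives [x^p = -x], against Fermat's
    [x^p = x]. *)
Lemma sum_squares_Fp p (s t : 'F_p) : prime p -> (p %% 4 = 3)%N -> s ^+ 2 + t ^+ 2 = 0 ->
  s = 0 /\ t = 0.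
Proof.
move=> pp p3 st; suff t0 : t = 0.
  by move: st; rewrite t0 expr0n addr0 => /eqP; rewrite expf_eq0 => /eqP.
apply/eqP; apply/negPn/negP => t0.
pose x := s / t; have x2 : x ^+ 2 = -1.
  rewrite expr_div_n; apply/(canLR (mulfK _)); rewrite ?expf_neq0 // mulN1r.
  by apply/eqP; rewrite -addr_eq0 st.
have x0 : x != 0 by apply: contra_eq_neq x2 => ->; rewrite expr0n eq_sym oppr_eq0 oner_neq0.
have : x ^+ p = x by have := expf_card x; rewrite card_Fp.
have -> : x ^+ p = x ^+ ((p %/ 4).*2.+1).*2.+1.
  by congr (_ ^+ _); have := divn_eq p 4; rewrite p3; lia.
rewrite exprS -mul2n exprM x2 -signr_odd /= odd_double mulrN1 => /eqP.
rewrite -subr_eq0 -opprD oppr_eq0 -mulr2n -mulr_natr mulf_eq0 (negPf x0) /=.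
rewrite -(dvdn_pcharf (pchar_Fp pp)) dvdn_prime2 // => /eqP p2; by rewrite p2 in p3.
Qed.

(** If the least prime factor is not 3 modulo 4, it is 1 modulo 4, and the cofactor is again 3
    modulo 4. *)
Lemma prime_factor_3mod4 m : (m %% 4 = 3)%N -> exists2 p, prime p & (p %| m)%N && (p %% 4 == 3)%N.
Proof.
elim/ltn_ind: m => m IH m3; have m1 : (1 < m)%N by case: m m3 {IH} => [|[]].
have pp := pdiv_prime m1; have pm := pdiv_dvd m.
have [p3|p3] := eqVneq (pdiv m %% 4)%N 3; first by exists (pdiv m); rewrite // pm p3.
have mE := divnK pm; set q := (m %/ pdiv m)%N in mE.
have q0 : (0 < q)%N by case: (q) mE m1 => // <-.
have qm : (q < m)%N by rewrite -mE ltn_Pmulr ?prime_gt1.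
have q3 : (q %% 4 = 3)%N.
  move: m3 p3; rewrite -{1}mE -modnMm.
  have := ltn_pmod q (isT : 0 < 4)%N; have := ltn_pmod (pdiv m) (isT : 0 < 4)%N.
  by move: (q %% 4)%N (pdiv m %% 4)%N => [|[|[|[|r]]]] [|[|[|[|t]]]].
have [p pp' /andP[pq p3']] := IH q qm q3; exists p => //.
by rewrite p3' andbT -mE dvdn_mulr.
Qed.

Lemma poly_norm_neq_odd n (A : {poly int}) : odd n -> poly_norm A = - Pr n -> False.
Proof.
move=> no /(congr1 (fun f : {poly int} => f`_0)).
rewrite coefN -Wr_coef_double coefB coefXM subr0 expr2 coef0M => N0.
have := Wr_coef0_gt0 no; rewrite ltNge => /negP; apply.
by rewrite -oppr_ge0 -N0 -expr2 sqr_ge0.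
Qed.

Lemma mod_poly_Pr p a : prime p -> odd p ->
  mod_poly p (Pr (a * p).+1) = 'X^(a * p) * ('X + 1).
Proof.
move=> pp po; rewrite -[RHS]even_poly_comp.
have -> : mod_poly p (Pr (a * p).+1) = even_poly (mod_poly p (Wr (a * p + 1))).
  by apply/polyP => i; rewrite coef_even_poly !coef_map addn1 -Wr_coef_double.
congr even_poly; rewrite modp_Wr // comp_polyM comp_polyD comp_Xn_poly comp_polyX.
rewrite comp_polyC -exprM mul2n; congr (_ * _).
have -> : Wr 1 = 'X^2 + 1.
  rewrite /Wr HeS (_ : He 1 = 'X) // (_ : He 0 = 1) // -!mul_polyC !polyC_natr; ring.
by rewrite /mod_poly rmorphD /= map_polyXn rmorph1.
Qed.

Lemma poly_norm_neq_even n (A : {poly int}) : (8 %| n)%N -> (0 < n)%N ->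
  poly_norm A = Pr n -> False.
Proof.
move=> n8 n0 NE; have m3 : (n.-1 %% 4 = 3)%N.
  by case/dvdnP: n8 n0 => q ->; lia.
have [p pp /andP[/dvdnP[a nE] /eqP p3]] := prime_factor_3mod4 m3.
have po : odd p by have := divn_eq p 4; rewrite p3; lia.
have nE' : n = (a * p).+1 by lia.
have := congr1 (mod_poly p) NE; rewrite nE' mod_poly_Pr //.
rewrite /mod_poly /poly_norm !expr2 rmorphB !rmorphM /= map_polyX.
move: (map_poly _ (even_poly A)) (map_poly _ (odd_poly A)) => e o E.
have hornerS := (hornerD, hornerN, hornerM, hornerX, hornerXn, hornerC).
have [e0 o0] : e.[-1] = 0 /\ o.[-1] = 0.
  apply: (sum_squares_Fp pp p3); have := congr1 (horner^~ (-1)) E.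
  by rewrite !hornerS addNr mulr0 mulN1r opprK !expr2.
(* At -1 the derivative of the left side vanishes with [e] and [o], while on the right the simple
   root leaves the sign [(-1)^(a p)]. *)
have /(congr1 (horner^~ (-1))) := congr1 (@deriv _) E.
rewrite derivB !derivM derivX derivD derivX derivC addr0 !hornerS e0 o0 addNr.
rewrite !(mul0r, mulr0, addr0, add0r, subr0, mulr1) => /esym/eqP.
by rewrite oppr0 signr_eq0.
Qed.

Lemma Wr_factor_trivial n k (A B : {poly int}) : (0 < n)%N -> n.+1 = (k ^ 2)%N ->
  Wr n = A * B -> size A = 1%N \/ size B = 1%N.
Proof.
move=> n0 nk WE; have irr := Pr_irreducible n0 nk.
have [sP Pm] := Pr_size_monic n.
have NE := poly_norm_mul_eq WE.
have WE' : Wr n = B * A by rewrite mulrC.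
have [A0 B0] : A != 0 /\ B != 0.
  have W0 : Wr n != 0.
    by apply/eqP => W0; have [] := Wr_coef_top n; rewrite W0 coef0.
  by move: W0; rewrite WE mulf_eq0 => /norP.
(* A norm prime to the irreducible [Pr n] but dividing its square is constant, and the norm
   preserves the degree. *)
have triv (C D : {poly int}) : C != 0 -> poly_norm C * poly_norm D = Pr n ^+ 2 ->
    ~~ (map_poly (intr : int -> rat) (Pr n) %| map_poly intr (poly_norm C)) -> size C = 1%N.
  move=> C0 CD; rewrite -irreducible_poly_coprime // => cop.
  have : map_poly (intr : int -> rat) (poly_norm C) %| 1 * map_poly intr (Pr n) ^+ 2.
    by rewrite mul1r -rmorphXn /= -CD rmorphM dvdp_mulr.
  rewrite Gauss_dvdpl; last by rewrite coprimep_expr // coprimep_sym.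
  by rewrite dvdp1 size_rat_int_poly size_poly_norm // => /eqP.
have [PA|/(triv A B A0 NE)] := boolP (map_poly (intr : int -> rat) (Pr n) %| map_poly intr (poly_norm A)); last by left.
have [PB|/(triv B A B0)] := boolP (map_poly (intr : int -> rat) (Pr n) %| map_poly intr (poly_norm B)); last first.
  by rewrite mulrC NE; right; auto.
exfalso; rewrite !dvdp_rat_int in PA PB.
have NA0 : poly_norm A != 0 by rewrite -size_poly_gt0 size_poly_norm // size_poly_gt0.
have NB0 : poly_norm B != 0 by rewrite -size_poly_gt0 size_poly_norm // size_poly_gt0.
have sA : size (poly_norm A) = n.+1.
  have := dvdp_leq NA0 PA; have := dvdp_leq NB0 PB.
  have := congr1 (fun f : {poly int} => size f) NE; rewrite size_mul // expr2 size_mul ?monic_neq0 // sP.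
  by move: (size _) (size _) => a b; lia.
have eqA : Pr n %= poly_norm A by rewrite -dvdp_size_eqp // sP sA.
have NAE : poly_norm A = lead_coef (poly_norm A) *: Pr n.
  by rewrite (eqp_eq eqA) (eqP Pm) scale1r.
have lAB : lead_coef A * lead_coef B = 1.
  by rewrite -lead_coefM -WE Wr_even lead_coef_comp ?size_polyXn // (eqP Pm) lead_coefXn expr1n.
have lA : lead_coef A ^+ 2 = 1.
  move/(congr1 absz): lAB; rewrite abszM => /eqP; rewrite muln_eq1 => /andP[/eqP l1 _].
  by rewrite -(@real_normK _ (lead_coef A)) ?num_real // -abszE l1.
rewrite lead_coef_poly_norm // -size_poly_norm // sA lA mulr1 /= in NAE.
have [no|ne] := boolP (odd n).
  apply: (@poly_norm_neq_odd n A no); rewrite NAE -signr_odd no scaleN1r //.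
apply: (@poly_norm_neq_even n A); last by rewrite NAE -signr_odd (negPf ne) scale1r.
  have k_odd : odd k by move: ne; rewrite -[odd n]negbK -oddS nk oddX; case: (odd k).
  (* With [k = 2m + 1], [n = 4 m (m + 1)], and one of [m], [m + 1] is even. *)
  have nE : (n = 4 * (k./2 * (k./2).+1))%N by have := odd_double_half k; rewrite k_odd; nia.
  by rewrite nE (_ : 8 = 4 * 2)%N // dvdn_pmul2l // dvdn2 oddM /=; case: (odd _).
by [].
Qed.

(** * The 2-core of [[:: n; n]] and the conclusion *)

Lemma remove2hook_pair a b : odd a != odd b -> (1 < a + b)%N ->
  exists a' b', [/\ remove2hook [:: a; b] = [:: a'; b'], odd a' != odd b' &
                     (a' + b').+2 = (a + b)%N].
Proof.
move=> ab ab2; rewrite /remove2hook /removable2 /=.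
have [a2|a2] := leqP 2 a => /=.
  have -> : (a - 2 \notin [:: a; b])%N.
    rewrite !inE negb_or; apply/andP; split; first lia.
    by apply: contraNneq ab => <-; rewrite oddB // addbF.
  by exists (a - 2)%N, b; rewrite /= oddB // addbF; split=> //; lia.
have b2 : (1 < b)%N by lia.
rewrite b2.
have -> : (b - 2 \notin [:: a; b])%N.
  rewrite !inE negb_or; apply/andP; split; last lia.
  by apply: contraNneq ab => <-; rewrite oddB ?addbF //; lia.
by exists a, (b - 2)%N; rewrite /= oddB // addbF; split=> //; lia.
Qed.

(** The two degrees keep opposite parities, so lowering one by 2 never hits the other, and the sum
    descends to 1, where the pair is fixed. *)
Lemma core2_pair m a b : odd a != odd b -> (a + b <= m.*2.+1)%N ->
  sumn (iter m remove2hook [:: a; b]) = 1%N.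
Proof.
elim: m a b => [|m IH] a b ab le_m; first by rewrite /=; case: a b ab le_m => [|[|a]] [|[|b]].
rewrite iterSr; have [ab1|ab2] := leqP (a + b) 1; last first.
  by have [a' [b' [-> ? ?]]] := remove2hook_pair ab ab2; apply: IH => //; lia.
have fix2 : remove2hook [:: a; b] = [:: a; b].
  by case: a b ab ab1 {le_m} => [|[|a]] [|[|b]].
by rewrite fix2; apply: IH => //; lia.
Qed.

Lemma core2_size_nn n : core2_size [:: n; n] = 0%N.
Proof.
rewrite /core2_size /core2_degs; have -> : degseq [:: n; n] = [:: n; n.+1].
  by rewrite /degseq /= addn0 addn1.
by rewrite core2_pair //=; [case: (odd n) | lia].
Qed.

Lemma HeW_nn n : HeW [:: n; n] = Wr n.
Proof.
rewrite /HeW; have -> : degseq [:: n; n] = [:: n; n.+1].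
  by rewrite /degseq /= addn0 addn1.
have -> : vdm [:: n; n.+1] = 1.
  rewrite /vdm !big_ord_recl big_ord0 /= [X in X * _]big_mkcond [X in _ * (X * _)]big_mkcond.
  rewrite !big_ord_recl !big_ord0 /=; ring.
have -> : wronskianHe [:: n; n.+1] = Wr n.
  rewrite Wr_wronskian /wronskianHe (expand_det_row _ ord0) !big_ord_recl big_ord0 /=.
  rewrite /cofactor !det_mx11 !mxE /=; ring.
apply/polyP => i; rewrite coef_map_id0 ?divz1 // div0z //.
Qed.

Theorem mainTheorem1 (n k : nat) :
  (1 <= n)%N -> n.+1 = (k ^ 2)%N -> irreducible_Zx (remainderPoly [:: n; n]).
Proof.
move=> n0 nk; have -> : remainderPoly [:: n; n] = Wr n.
  apply/polyP => i; rewrite /remainderPoly core2_size_nn HeW_nn.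
  by rewrite coef_drop_poly addn0.
have [sP Pm] := Pr_size_monic n.
have W_monic : Wr n \is monic.
  by rewrite monicE Wr_even lead_coef_comp ?size_polyXn // (eqP Pm) lead_coefXn expr1n.
have unit1 (A B : {poly int}) : Wr n = A * B -> size A = 1%N -> A \is a GRing.unit.
  move=> WE sA; rewrite poly_unitE sA eqxx /=; apply/unitrPr; exists (lead_coef B).
  have -> : A`_0 = lead_coef A by rewrite lead_coefE sA.
  by rewrite -lead_coefM -WE (eqP W_monic).
split; [|split].
- by apply: monic_neq0.
- rewrite poly_unitE; apply/negP => /andP[/eqP sW _].
  have [c _] := Wr_coef_top n.
  by move/eqP: c; rewrite nth_default ?sW ?double_gt0 // eq_sym oner_eq0.
move=> A B WE; have [sA|sB] := Wr_factor_trivial n0 nk WE.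
  by left; apply: unit1 WE sA.
by right; rewrite mulrC in WE; apply: unit1 WE sB.
Qed.
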